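(* Let $n\ge3$ and let $f(x_1,\dots,x_n)\in\mathbf{Q}[x_1,\dots,x_n]$ be an irreducible polynomial of degree $2$. Suppose that $f$ cannot be expressed as a polynomial in two linear forms in $(x_1,\dots,x_n)$, or that the homogeneous quadratic part of $f$ is irreducible in $\mathbf{Q}[x_1,\dots,x_n]$. Then for all $B\ge1$ and $\varepsilon>0$, $n(f;B)=O_{n,\varepsilon}(B^{n-2+\varepsilon})$.
   Context: For a polynomial $f\in\mathbf{Q}[x_1,\dots,x_n]$ and $B\ge1$, $n(f;B)$ denotes the number of integral $n$-tuples $(a_1,\dots,a_n)\in\mathbf{Z}^n\cap[-B,B]^n$ with $f(a_1,\dots,a_n)=0$. Subscripts on $O$ indicate the only parameters on which the implied constant depends. *)

(* Defs.v *)
From HB Require Import structures.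
From mathcomp Require Import all_boot all_algebra.
From mathcomp Require Import mpoly.
From Stdlib Require Reals.

Set Implicit Arguments.
Unset Strict Implicit.
Unset Printing Implicit Defensive.

Import GRing.Theory.
Local Open Scope ring_scope.

(* Irreducibility in Q[x_1..x_n]: f is a non-unit, nonzero (i.e. non-constant)
   and every factorisation has a unit (nonzero constant) factor. *)
Definition mirreducible (n : nat) (f : {mpoly rat[n]}) : Prop :=
  (1 < msize f)%N /\
  forall g h : {mpoly rat[n]}, f = g * h -> (msize g <= 1)%N \/ (msize h <= 1)%N.

(* total degree of f equals d (msize = total degree + 1, msize 0 = 0) *)
Definition mtotdeg_eq (n : nat) (f : {mpoly rat[n]}) (d : nat) : Prop :=
  msize f = d.+1.

Definition linear_form (n : nat) (L : {mpoly rat[n]}) : Prop :=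
  L \is 1.-homog.

Definition poly_in_two_linear_forms (n : nat) (f : {mpoly rat[n]}) : Prop :=
  exists (g : {mpoly rat[2]}) (L1 L2 : {mpoly rat[n]}),
    linear_form L1 /\ linear_form L2 /\ f = g \mPo [tuple L1; L2].

Definition quad_part (n : nat) (f : {mpoly rat[n]}) : {mpoly rat[n]} :=
  pihomog mdeg 2 f.

(* n(f;B): the number of integer points a in [-B,B]^n with f(a) = 0.
   With N = floor B, integer points of [-B,B] are -N..N, encoded by
   k : 'I_(2N+1) |-> k - N. *)
Definition box_point (n N : nat) (a : {ffun 'I_n -> 'I_(2 * N + 1)}) : 'I_n -> rat :=
  fun i => ((Posz (a i)) - Posz N)%:~R.

Definition nfB (n : nat) (f : {mpoly rat[n]}) (B : Rdefinitions.R) : nat :=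
  let N := BinInt.Z.to_nat (R_Ifp.Int_part B) in
  #|[set a : {ffun 'I_n -> 'I_(2 * N + 1)} | f.@[box_point a] == 0]|.

(* Main.v *)
(* There are integer directions [u], [v] with entries at most 1 on which the quadratic
   part of [f] is nondegenerate: this needs only that its rank is at least 2, which
   both hypotheses provide. Slicing the box by the planes [t + Zu + Zv] leaves
   O(B^(n-2)) conics of fixed quadratic part (a, b, c), with D = b^2 - 4ac <> 0.

   A nonsingular conic has O(B^eps) integer points in the box, uniformly in its
   coefficients. Five of its points determine it, so in the frame of three of them
   it has integer coefficients bounded by a power of B. Completing the square gives
   z^2 - D x^2 = m with D, m polynomially bounded; the solutions split into at most
   tau(m)^2 classes, and two solutions of one class differ by a unit of norm 4, so
   that a class has O(log B) members in the box.

   A singular conic with D not a square has at most one rational point. If D is a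
   square, a singular conic has O(B) points, but the discriminant of the slice is a
   quadratic polynomial in [t], and it is nonzero because otherwise f would factor
   over Q; hence only O(B^(n-3)) slices are singular. *)

Require Import Defs.
From HB Require Import structures.
From mathcomp Require Import all_boot all_order all_algebra zify ring lra.
From mathcomp Require Import mpoly.
From Stdlib Require Import Classical.
From Stdlib Require Reals Lra Lia.

Set Implicit Arguments.
Unset Strict Implicit.
Unset Printing Implicit Defensive.

Import Order.TTheory GRing.Theory Num.Theory.

(** * Fibre counting and the divisor bound *)


(** The implied constant may not depend on the coefficients of [f], not even through their height.
    This is why a conic is rewritten in terms of its own points, lists of at most four points being
    bounded outright. It is also why no fundamental unit is chosen: solutions of one class are
    compared with each other, and for [D > 0] a nontrivial quotient enlarges the solution by a fixed
    factor whatever [D] is. The case split on [D] being a rational square is forced. The polynomial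
    [x_1^2 - 2 x_2^2] satisfies the hypotheses through its quadratic part, yet all its slices along
    the first two coordinates are singular. For square [D] a singular slice may contain a line, so
    there the saving has to come from the number of singular slices. The exponent [eps] is traded
    for a natural number [k] with [1 <= k * eps]: estimates bound the [k]-th power of a count, and
    everything before the last step stays in natural numbers. *)

Lemma size_le_fibers (T U : eqType) (h : T -> U) (s : seq T) (r : seq U) M :
  (forall x, x \in s -> h x \in r) ->
  (forall y, y \in r -> size [seq x <- s | h x == y] <= M) ->
  size s <= M * size r.
Proof.
elim: r s => [|y r IHr] s hr hM.
  by case: s hr {hM} => // x s /(_ x); rewrite mem_head => /(_ isT).
have /= -> : size s = size [seq x <- s | h x == y] + size [seq x <- s | h x != y].
  by rewrite !size_filter -(count_predC (fun x => h x == y)).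
rewrite mulnS leq_add ?hM ?mem_head //; apply: IHr => [x|z zr].
  by rewrite mem_filter => /andP[nxy /hr]; rewrite inE (negbTE nxy).
apply: leq_trans (hM z _); last by rewrite inE zr orbT.
rewrite -filter_predI !size_filter; apply: sub_count => x /=.
by case/andP.
Qed.

Lemma size_le_inj (T U : eqType) (h : T -> U) (s : seq T) (r : seq U) :
  uniq s -> {in s &, injective h} -> (forall x, x \in s -> h x \in r) ->
  size s <= size r.
Proof.
move=> us hi hr; rewrite -(size_map h); apply: uniq_leq_size.
  by rewrite map_inj_in_uniq.
by move=> _ /mapP[x xs ->]; apply: hr.
Qed.

(** Since [e + 1 <= k * (e %/ k + 1) <= k * 2 ^ (e %/ k)], taking [k]-th powers suffices. It absorbs
    powers of the exponent of a prime, and later powers of a logarithm. *)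
Lemma expn_succ_le k e : 0 < k -> e.+1 ^ k <= k ^ k * 2 ^ e.
Proof.
move=> k0; apply: leq_trans (_ : (k * 2 ^ (e %/ k)) ^ k <= _).
  rewrite leq_exp2r //; apply: leq_trans (_ : k * (e %/ k).+1 <= _).
    by rewrite mulnC ltn_ceil.
  by rewrite leq_mul2l ltn_expl // orbT.
rewrite expnMn leq_mul2l -expnM leq_exp2l // leq_trunc_div.
by rewrite orbT.
Qed.

Definition tau m := size (divisors m).

Lemma tau_partn p m : prime p -> 0 < m ->
  tau m <= (logn p m).+1 * tau (m`_p^').
Proof.
move=> pp m0; rewrite /tau.
pose h x := (logn p x, x`_p^').
have := @size_le_inj _ _ h (divisors m)
  [seq (i, x) | i <- iota 0 (logn p m).+1, x <- divisors (m`_p^')].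
rewrite size_allpairs size_iota; apply.
- exact: divisors_uniq.
- move=> x y; rewrite -!dvdn_divisors // => xm ym [e1 e2].
  rewrite -(partnC p (dvdn_gt0 m0 xm)) -(partnC p (dvdn_gt0 m0 ym)).
  by rewrite !p_part e1 e2.
- move=> x; rewrite -!dvdn_divisors // => xm.
  apply/allpairsP; exists (h x); split=> //.
    by rewrite mem_iota add0n ltnS dvdn_leq_log.
  by rewrite -dvdn_divisors ?part_gt0 // partn_dvd.
Qed.

(** A prime [p >= 2 ^ k] with exponent [e] contributes [(e + 1) ^ k <= 2 ^ (e * k) <= p ^ e], so
    large primes cost no constant. *)
Lemma tau_rough k m : 0 < m -> (forall p, p \in primes m -> 2 ^ k <= p) ->
  tau m ^ k <= m.
Proof.
elim/ltn_ind: m => m IHm m0 hp.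
have [m1|m1] := leqP m 1; first by (have -> : m = 1%N by lia); rewrite (_ : tau 1 = 1) ?exp1n.
have [|] := posnP k; first by move->; rewrite expn0.
move=> k0; have pp := pdiv_prime m1; set p := pdiv m in pp.
have pm : p \in primes m by rewrite mem_primes pp m0 pdiv_dvd.
have e0 : 0 < logn p m by rewrite logn_gt0.
have mE : m = p ^ logn p m * m`_p^' by rewrite -p_part partnC.
have m'0 : 0 < m`_p^' by apply: part_gt0.
have pe : 1 < p ^ logn p m by rewrite -(expn0 p) ltn_exp2l ?prime_gt1.
have lt : m`_p^' < m by rewrite [X in _ < X]mE; nia.
have hp' q : q \in primes m`_p^' -> 2 ^ k <= q.
  move=> qm; apply: hp; move: qm; rewrite !mem_primes m0 => /and3P[-> _ d] /=.
  by apply: dvdn_trans d (dvdn_part _ _).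
apply: leq_trans (_ : ((logn p m).+1 * tau m`_p^') ^ k <= _).
  by rewrite leq_exp2r // tau_partn.
rewrite expnMn [X in _ <= X]mE leq_mul //; last exact: IHm.
apply: leq_trans (_ : (2 ^ logn p m) ^ k <= _); first by rewrite leq_exp2r // ltn_expl.
by rewrite -expnM mulnC expnM leq_exp2r // hp.
Qed.

Lemma tau_bound_from k N : 0 < k -> exists C, forall m, 0 < m ->
  (forall p, p \in primes m -> 2 ^ k - N <= p) -> tau m ^ k <= C * m.
Proof.
move=> k0; elim: N => [|N [C IHC]].
  by exists 1 => m m0 hp; rewrite mul1n tau_rough // => p /hp; rewrite subn0.
exists (C + k ^ k * C) => m m0 hp; set p := 2 ^ k - N.+1 in hp.
have [pp|npp] := boolP (p \in primes m); last first.
  apply: leq_trans (IHC m m0 _) _; last by rewrite mulnDl leq_addr.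
  move=> q qm; have := hp q qm; rewrite /p subnS => hq.
  have : q != p by apply: contraNneq npp => <-.
  by rewrite /p subnS; lia.
have pr : prime p by move: pp; rewrite mem_primes; case/and3P.
have mE : m = p ^ logn p m * m`_p^' by rewrite -p_part partnC.
apply: leq_trans (_ : ((logn p m).+1 * tau m`_p^') ^ k <= _).
  by rewrite leq_exp2r // tau_partn.
have IH : tau m`_p^' ^ k <= C * m`_p^'.
  apply: IHC (part_gt0 _ _) _ => q qm.
  have qm' : q \in primes m.
    move: qm; rewrite !mem_primes m0 => /and3P[-> _ d] /=.
    by apply: dvdn_trans d (dvdn_part _ _).
  have : q != p.
    apply: contraTneq qm => ->; rewrite primes_part mem_filter /= .
    by rewrite !inE eqxx.
  have := hp q qm'; rewrite /p subnS; lia.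
rewrite expnMn; apply: leq_trans (_ : k ^ k * 2 ^ logn p m * (C * m`_p^') <= _).
  by rewrite leq_mul // expn_succ_le.
rewrite [X in _ <= _ * X]mE.
have : 2 ^ logn p m <= p ^ logn p m.
  have [->//|e0] := posnP (logn p m).
  by rewrite leq_exp2r // prime_gt1.
move: (2 ^ _) (p ^ _) (m`_p^') (k ^ k) => a b c d ab.
have : d * a * (C * c) <= d * b * (C * c) by rewrite !leq_mul.
by lia.
Qed.

Lemma tau_bound k : 0 < k -> exists C, forall m, 0 < m -> tau m ^ k <= C * m.
Proof.
move=> k0; have [C hC] := tau_bound_from (2 ^ k) k0; exists C => m m0.
by apply: hC => // p _; rewrite subnn.
Qed.

Local Open Scope ring_scope.

(** * Uniform bound for [z^2 - D x^2 = m] *)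

Definition squarefreez (D : int) := forall s : int, (s * s %| D)%Z -> `|s|%N = 1%N.

Lemma coprimezW (m n p : int) : (m %| n)%Z -> coprimez p n -> coprimez p m.
Proof. by rewrite dvdzE !coprimezE; apply: coprime_dvdr. Qed.

Lemma coprimez_norm (D m z x : int) :
  z ^+ 2 - D * x ^+ 2 = m -> coprimez z x -> coprimez x m.
Proof.
move=> <- czx; have -> : z ^+ 2 - D * x ^+ 2 = (- D * x) * x + z ^+ 2 by ring.
by rewrite /coprimez gcdzMDl -/(coprimez _ _) coprimez_sym coprimezXl.
Qed.

(* The class of a primitive solution is its gcd [d] below with the reference solution
   [(z0, x0)]: it fixes [z1 / x1] modulo [d] and modulo [m / d], and the gcd of these
   two moduli divides 2 as [D] is squarefree. *)
Lemma norm_class_dvd (D m z0 x0 z1 x1 z2 x2 : int) :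
  squarefreez D -> m != 0 ->
  z0 ^+ 2 - D * x0 ^+ 2 = m -> z1 ^+ 2 - D * x1 ^+ 2 = m ->
  z2 ^+ 2 - D * x2 ^+ 2 = m ->
  coprimez z0 x0 -> coprimez z1 x1 ->
  gcdz (z1 * x0 - z0 * x1) m = gcdz (z2 * x0 - z0 * x2) m ->
  (m %| 2%:R * (z1 * x2 - z2 * x1))%Z.
Proof.
move=> sqD m0 E0 E1 E2 c0 c1 Eg; set d := gcdz _ m in Eg.
have cx0 := coprimez_norm E0 c0; have cx1 := coprimez_norm E1 c1.
have dm : (d %| m)%Z by apply: dvdz_gcdr.
have [e mE] := dvdzP dm.
have d0 : d != 0 by apply: contraNneq m0 => d0; rewrite mE d0 mulr0.
have e0 : e != 0 by apply: contraNneq m0 => e0; rewrite mE e0 mul0r.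
have em : (e %| m)%Z by rewrite mE dvdz_mulr.
(* The product of [z x0 - z0 x] and [z x0 + z0 x] is [(x0^2 - x^2) m], both solutions having norm
   [m]. As [d] is the exact gcd of the first factor with [m = e d], the rest of that factor is prime
   to [e], and [e] must divide the second. *)
have cofactor z x : z ^+ 2 - D * x ^+ 2 = m -> gcdz (z * x0 - z0 * x) m = d ->
    (e %| z * x0 + z0 * x)%Z.
  move=> E Ed; have [a aE] : exists a, z * x0 - z0 * x = a * d.
    by apply/dvdzP; rewrite -Ed dvdz_gcdl.
  have cae : coprimez e a.
    have : gcdz (a * d) (e * d) = d by rewrite -mE -aE.
    rewrite -mulz_gcdl /coprimez gcdzC => h; apply/eqP.
    have d_ge0 : 0 <= d by rewrite /d /gcdz.
    by move: h; rewrite gez0_abs // -[X in _ = X]mul1r => /(mulIf d0).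
  rewrite -(Gauss_dvdzr _ cae) -(dvdz_mul2r d0) -mE.
  have -> : a * (z * x0 + z0 * x) * d = (x0 ^+ 2 - x ^+ 2) * m.
    rewrite mulrAC -aE -{1}E.
    have E' : z0 ^+ 2 = z ^+ 2 - D * x ^+ 2 + D * x0 ^+ 2 by rewrite E -E0; ring.
    have -> : (z * x0 - z0 * x) * (z * x0 + z0 * x) =
              z ^+ 2 * x0 ^+ 2 - z0 ^+ 2 * x ^+ 2 by ring.
    by rewrite E'; ring.
  exact: dvdz_mull.
have A1 : (d %| z1 * x0 - z0 * x1)%Z by apply: dvdz_gcdl.
have A2 : (d %| z2 * x0 - z0 * x2)%Z by rewrite Eg; apply: dvdz_gcdl.
have B1 : (e %| z1 * x0 + z0 * x1)%Z by apply: cofactor.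
have B2 : (e %| z2 * x0 + z0 * x2)%Z by apply: cofactor.
have cd : coprimez d x0 by rewrite coprimez_sym; apply: coprimezW dm cx0.
have ce : coprimez e x0 by rewrite coprimez_sym; apply: coprimezW em cx0.
set W := z1 * x2 - z2 * x1.
have dW : (d %| W)%Z.
  rewrite -(Gauss_dvdzr _ cd).
  have -> : x0 * W = (z1 * x0 - z0 * x1) * x2 - (z2 * x0 - z0 * x2) * x1.
    by rewrite /W; ring.
  by rewrite rpredB // dvdz_mulr.
have eW : (e %| W)%Z.
  rewrite -(Gauss_dvdzr _ ce).
  have -> : x0 * W = (z1 * x0 + z0 * x1) * x2 - (z2 * x0 + z0 * x2) * x1.
    by rewrite /W; ring.
  by rewrite rpredB // dvdz_mulr.
set h := gcdz d e.
have hd : (h %| d)%Z by apply: dvdz_gcdl.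
have he : (h %| e)%Z by apply: dvdz_gcdr.
have hm : (h %| m)%Z by apply: dvdz_trans hd dm.
have hhm : (h * h %| m)%Z by rewrite mE mulrC dvdz_mul.
have mWh : (m %| W * h)%Z.
  have [a [b hE]] := Bezoutz d e; rewrite /h -hE mulrDr mE.
  have -> : W * (a * d) + W * (b * e) = d * W * a + W * e * b by ring.
  by rewrite rpredD // dvdz_mulr // mulrC dvdz_mul.
suff h2 : (h %| 2%:R)%Z.
  have [q ->] := dvdzP h2.
  by rewrite -mulrA (mulrC h) dvdz_mull.
have hz : (h %| 2%:R * z1)%Z.
  have ch : coprimez h x0 by rewrite coprimez_sym; apply: coprimezW hm cx0.
  rewrite -(Gauss_dvdzr _ ch).
  have -> : x0 * (2%:R * z1) = (z1 * x0 - z0 * x1) + (z1 * x0 + z0 * x1) by ring.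
  by rewrite rpredD // ?(dvdz_trans hd A1) ?(dvdz_trans he B1).
(* On the first solution [4 D x1^2 = (2 z1)^2 - 4 m], where [h^2] divides both terms and [h] is
   prime to [x1]. Squarefreeness of [D] then leaves only [h] dividing 2, by parity of [h]. *)
have h4D : (h * h %| 4%:R * D)%Z.
  have ch : coprimez (h * h) (x1 * x1).
    rewrite coprimezMl coprimezMr.
    have -> : coprimez h x1 by rewrite coprimez_sym; apply: coprimezW hm cx1.
    by [].
  rewrite -(Gauss_dvdzr _ ch).
  have -> : x1 * x1 * (4%:R * D) = 2%:R * z1 * (2%:R * z1) - 4%:R * m by rewrite -E1; ring.
  by apply: rpredB; [apply: dvdz_mul | apply: dvdz_mull].
have [[f fE]|odd_h] : (exists f, h = f * 2%:R) \/ coprimez h 2%:R.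
- rewrite coprimezE coprimen2; have [|no] := boolP (odd _); first by right.
  by left; apply/dvdzP; rewrite dvdzE dvdn2.
- rewrite fE -[X in (_ %| X)%Z]mul1r dvdz_mul //; last first.
  have ff : (f * f %| D)%Z.
    have n4 : (4%:R : int) != 0 by [].
    rewrite -(dvdz_mul2l n4).
    by move: h4D; rewrite fE; congr (_ %| _)%Z; ring.
  by rewrite dvdzE (sqD _ ff).
have : (h * h %| D)%Z.
  have c4 : coprimez (h * h) 4%:R by rewrite (_ : 4%:R = 2%:R * 2%:R :> int) // coprimezMl coprimezMr odd_h.
  by rewrite -(Gauss_dvdzr _ c4).
by move/sqD => h1; rewrite dvdzE h1 dvd1n.
Qed.

(** Here [(u + v sqrt D) / 2] is the quotient of [z2 + x2 sqrt D] by [z1 + x1 sqrt D], an element of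
    norm 1. The divisibility assumed for [v] implies the one for [u]: with [V = z1 z2 - D x1 x2] and
    [W = z1 x2 - z2 x1], [V^2 - D W^2 = m^2], so [m^2] divides [(2 V)^2]. *)
Lemma norm_quotient (D m z1 x1 z2 x2 : int) : m != 0 ->
  z1 ^+ 2 - D * x1 ^+ 2 = m -> z2 ^+ 2 - D * x2 ^+ 2 = m ->
  (m %| 2%:R * (z1 * x2 - z2 * x1))%Z ->
  exists u v, [/\ u * m = 2%:R * (z1 * z2 - D * x1 * x2),
    v * m = 2%:R * (z1 * x2 - z2 * x1), u ^+ 2 - D * v ^+ 2 = 4%:R,
    (2%:R * z2 = u * z1 + D * v * x1 /\ 2%:R * x2 = u * x1 + v * z1) &
    (2%:R * z1 = u * z2 - D * v * x2 /\ 2%:R * x1 = u * x2 - v * z2)].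
Proof.
move=> m0 E1 E2 /dvdzP[v vE].
set V := z1 * z2 - D * x1 * x2; set W := z1 * x2 - z2 * x1 in vE *.
have VW : V ^+ 2 - D * W ^+ 2 = m ^+ 2.
  by rewrite [in RHS]expr2 -{1}E1 -E2 /V /W; ring.
have /dvdzP[u uE] : (m %| 2%:R * V)%Z.
  rewrite -(@dvdz_pexp2r _ _ 2) //.
  have -> : (2%:R * V) ^+ 2 = m ^+ 2 * 4%:R + D * (2%:R * W) ^+ 2.
    by rewrite -VW; ring.
  rewrite vE exprMn [D * _]mulrA; apply: rpredD.
    exact: dvdz_mulr (dvdzz _).
  exact: dvdz_mull (dvdzz _).
exists u, v; split=> //.
- apply: (mulfI m0); apply: (mulfI m0).
  have -> : m * (m * (u ^+ 2 - D * v ^+ 2)) = (u * m) ^+ 2 - D * (v * m) ^+ 2 by ring.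
  rewrite -uE -vE; transitivity (4%:R * (V ^+ 2 - D * W ^+ 2)); first by ring.
  by rewrite VW; ring.
- split; apply: (mulfI m0).
  + have -> : m * (u * z1 + D * v * x1) = (u * m) * z1 + D * (v * m) * x1 by ring.
    by rewrite -uE -vE -{1}E1 /V /W; ring.
  + have -> : m * (u * x1 + v * z1) = (u * m) * x1 + (v * m) * z1 by ring.
    by rewrite -uE -vE -{1}E1 /V /W; ring.
- split; apply: (mulfI m0).
  + have -> : m * (u * z2 - D * v * x2) = (u * m) * z2 - D * (v * m) * x2 by ring.
    by rewrite -uE -vE -{1}E2 /V /W; ring.
  + have -> : m * (u * x2 - v * z2) = (u * m) * x2 - (v * m) * z2 by ring.
    by rewrite -uE -vE -{1}E2 /V /W; ring.
Qed.

(** A ratio above 2 is what makes the integer binary logarithms differ. *)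
Lemma trunc_log2_lt (a b : int) : 0 < a -> 9%:R * a <= 4%:R * b ->
  trunc_log 2 `|a| = trunc_log 2 `|b| -> False.
Proof.
move=> a0 ab E.
have b0 : (0 < `|b|)%N by lia.
have a0' : (0 < `|a|)%N by lia.
have := @trunc_logP 2 `|a| isT a0'; have := @trunc_log_ltn 2 `|b| isT.
rewrite E expnS; lia.
Qed.

(** A nonpositive [u] would make [z1] and [x1] vanish by the inverse relations. Then
    [u^2 = 4 + D v^2 >= 5] gives [u >= 3], and each coordinate grows by a factor at least 3 / 2. *)
Lemma unit_step_grow (D u v z1 x1 z2 x2 : int) : 0 < D -> 0 < v ->
  u ^+ 2 - D * v ^+ 2 = 4%:R -> 0 <= z1 -> 0 <= x1 -> 0 <= z2 -> 0 <= x2 ->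
  0 < z1 ^+ 2 + x1 ^+ 2 ->
  2%:R * z2 = u * z1 + D * v * x1 -> 2%:R * x2 = u * x1 + v * z1 ->
  2%:R * z1 = u * z2 - D * v * x2 -> 2%:R * x1 = u * x2 - v * z2 ->
  9%:R * (z1 ^+ 2 + x1 ^+ 2) <= 4%:R * (z2 ^+ 2 + x2 ^+ 2).
Proof.
move=> D0 v0 uv z10 x10 z20 x20 p1 F1 F2 G1 G2.
have Dv : 1 <= D * v ^+ 2 by rewrite -gtz0_ge1 mulr_gt0 // exprn_gt0.
have a1 : 0 <= D * v * x1 by rewrite !mulr_ge0 // ltW.
have a2 : 0 <= D * v * x2 by rewrite !mulr_ge0 // ltW.
have b1 : 0 <= v * z1 by rewrite !mulr_ge0 // ltW.
have b2 : 0 <= v * z2 by rewrite !mulr_ge0 // ltW.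
have u0 : 0 < u.
  rewrite ltNge; apply/negP => u0.
  have c1 : u * z2 <= 0 by rewrite mulr_le0_ge0.
  have c2 : u * x2 <= 0 by rewrite mulr_le0_ge0.
  have h1 : z1 = 0 by clear - G1 a2 c1 z10; lia.
  have h2 : x1 = 0 by clear - G2 b2 c2 x10; lia.
  by move: p1; rewrite h1 h2.
have u3 : 3%:R <= u.
  rewrite leNgt; apply/negP => u3.
  have : u ^+ 2 <= 2%:R ^+ 2 by rewrite lerXn2r ?nnegrE ?(ltW u0) //; clear - u3; lia.
  by move: uv Dv; clear; move: (u ^+ 2) (D * _); lia.
have grow (a b : int) : 0 <= a -> 0 <= b -> u * a <= 2%:R * b ->
    9%:R * a ^+ 2 <= 4%:R * b ^+ 2.
  move=> a0 b0 ab.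
  have -> : 9%:R * a ^+ 2 = (3%:R * a) ^+ 2 by ring.
  have -> : 4%:R * b ^+ 2 = (2%:R * b) ^+ 2 by ring.
  rewrite lerXn2r ?nnegrE ?mulr_ge0 //; apply: le_trans ab.
  exact: ler_wpM2r.
by rewrite !mulrDr lerD // grow // ?F1 ?F2 lerDl.
Qed.

(* The quotient of two solutions of a class is [(u + v sqrt D) / 2] with [u >= 3] or
   [v = 0], so distinct solutions have sizes at ratio at least [9 / 4]. *)
Lemma real_class_inj (D m z1 x1 z2 x2 : int) : m != 0 -> 0 < D ->
  z1 ^+ 2 - D * x1 ^+ 2 = m -> z2 ^+ 2 - D * x2 ^+ 2 = m ->
  0 <= z1 -> 0 <= x1 -> 0 <= z2 -> 0 <= x2 ->
  (m %| 2%:R * (z1 * x2 - z2 * x1))%Z ->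
  trunc_log 2 `|z1 ^+ 2 + x1 ^+ 2| = trunc_log 2 `|z2 ^+ 2 + x2 ^+ 2| ->
  (z1, x1) = (z2, x2).
Proof.
move=> m0 D0 E1 E2 z10 x10 z20 x20 dv Et.
have [u [v [uE vE uv [F1 F2] [G1 G2]]]] := norm_quotient m0 E1 E2 dv.
have pos (z x : int) : z ^+ 2 - D * x ^+ 2 = m -> 0 <= z -> 0 <= x -> 0 < z ^+ 2 + x ^+ 2.
  move=> E z0 x0; rewrite lt_neqAle addr_ge0 ?sqr_ge0 // andbT eq_sym.
  apply: contraNneq m0 => /eqP; rewrite paddr_eq0 ?sqr_ge0 //.
  by case/andP=> /eqP a /eqP b; rewrite -E a b mulr0 subrr.
have p1 := pos _ _ E1 z10 x10; have p2 := pos _ _ E2 z20 x20.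
have [vneg|vpos|v0] := ltgtP v 0.
(* For [v < 0] the inverse quotient, with [- v], leads from the second solution to the first. *)
- exfalso; apply: (trunc_log2_lt p2 _ (esym Et)).
  apply: (@unit_step_grow D u (- v)) => //; first by rewrite oppr_gt0.
  + by rewrite sqrrN.
  + by rewrite G1; ring.
  + by rewrite G2; ring.
  + by rewrite F1; ring.
  + by rewrite F2; ring.
- exfalso; apply: (trunc_log2_lt p1 _ Et).
  exact: (@unit_step_grow D u v).
have : u = 2 \/ u = -2.
  have /eqP : (u - 2) * (u + 2) = 0.
    by transitivity (u ^+ 2 - D * v ^+ 2 - 4%:R); [rewrite v0; ring | rewrite uv subrr].
  by rewrite mulf_eq0 => /orP[] /eqP; lia.
case=> uu; rewrite v0 uu in F1 F2 G1 G2; last first.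
  exfalso; have : z1 = 0 by lia.
  have : x1 = 0 by lia.
  by move=> h1 h2; move: p1; rewrite h1 h2; lia.
by congr pair; lia.
Qed.

Definition irange (M : nat) : seq int := [seq i%:Z - M%:Z | i <- iota 0 (2 * M).+1].

Lemma size_irange M : size (irange M) = (2 * M).+1.
Proof. by rewrite size_map size_iota. Qed.

Lemma mem_irange M (x : int) : (x \in irange M) = (`|x| <= M%:Z).
Proof.
apply/mapP/idP => [[i]|xM]; first by rewrite mem_iota => h ->; lia.
exists (absz (x + M%:Z)); last by lia.
by rewrite mem_iota; lia.
Qed.

Lemma norm_le2 (a : int) : a ^+ 2 <= 4%:R -> `|a| <= 2%:R.
Proof. by move=> h; rewrite -ler_sqr ?nnegrE // real_normK ?num_real. Qed.

(** For [D < 0] the equation [u^2 - D v^2 = 4] forces [u] and [v] into [-2, 2], which leaves at most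
    25 quotients by a fixed solution. For [D > 0] the logarithm of [z^2 + x^2 <= 2 H^2] separates
    solutions and takes at most one value more than its maximum. The constant 26 is 25 + 1. *)
Lemma norm_class_size (D m : int) (H : nat) (s : seq (int * int)) :
  m != 0 -> D != 0 -> uniq s ->
  (forall p, p \in s -> [/\ p.1 ^+ 2 - D * p.2 ^+ 2 = m, 0 <= p.1 & 0 <= p.2]) ->
  (forall p, p \in s -> p.1 <= H%:Z /\ p.2 <= H%:Z) ->
  {in s &, forall p q, (m %| 2%:R * (p.1 * q.2 - q.1 * p.2))%Z} ->
  (size s <= 26 + trunc_log 2 (2 * H ^ 2))%N.
Proof.
move=> m0 D0 us hs hH hd.
have [Dneg|Dpos|/eqP] := ltgtP D 0; last by rewrite (negPf D0).
  case: s us hs hH hd => // p s us hs hH hd.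
  have ps : p \in p :: s by rewrite mem_head.
  pose h (q : int * int) := ((2%:R * (p.1 * q.1 - D * p.2 * q.2) %/ m)%Z,
                             (2%:R * (p.1 * q.2 - q.1 * p.2) %/ m)%Z).
  have hP q : q \in p :: s -> exists u v, [/\ h q = (u, v), u \in irange 2, v \in irange 2,
     2%:R * q.1 = u * p.1 + D * v * p.2 & 2%:R * q.2 = u * p.2 + v * p.1].
    move=> qs; have [E1 _ _] := hs _ ps; have [E2 _ _] := hs _ qs.
    have [u [v [uE vE uv [F1 F2] _]]] := norm_quotient m0 E1 E2 (hd _ _ ps qs).
    exists u, v; split; rewrite ?mem_irange //.
    - by rewrite /h -uE -vE !mulzK.
    - have : 0 <= - D * v ^+ 2 by rewrite mulr_ge0 ?sqr_ge0 // oppr_ge0 ltW.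
      by move=> k; apply: norm_le2; move: uv k; clear; lia.
    - have : v ^+ 2 <= - D * v ^+ 2.
        by rewrite ler_peMl ?sqr_ge0 //; clear - Dneg; lia.
      have : 0 <= u ^+ 2 by apply: sqr_ge0.
      by move=> k k'; apply: norm_le2; move: uv k k'; clear; lia.
  have := @size_le_inj _ _ h (p :: s) [seq (u, v) | u <- irange 2, v <- irange 2] us.
  rewrite size_allpairs => hle; apply: leq_trans (hle _ _) _; last by rewrite leq_addr.
    move=> q q' /hP[u [v [-> _ _ F1 F2]]] /hP[u' [v' [-> _ _ F1' F2']]] [uu vv].
    rewrite [q]surjective_pairing [q']surjective_pairing; congr pair.
      by apply: (@mulfI _ 2%:R) => //; rewrite F1 F1' uu vv.
    by apply: (@mulfI _ 2%:R) => //; rewrite F2 F2' uu vv.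
  move=> q /hP[u [v [-> ur vr _ _]]].
  by apply/allpairsP; exists (u, v).
pose h (q : int * int) := trunc_log 2 `|q.1 ^+ 2 + q.2 ^+ 2|.
have := @size_le_inj _ _ h s (iota 0 (trunc_log 2 (2 * H ^ 2)).+1) us.
rewrite size_iota => hle; apply: leq_trans (hle _ _) _; last by lia.
  move=> q q' qs qs' e.
  have [E1 a1 b1] := hs _ qs; have [E2 a2 b2] := hs _ qs'.
  rewrite [q]surjective_pairing [q']surjective_pairing.
  exact: (real_class_inj m0 Dpos E1 E2 a1 b1 a2 b2 (hd _ _ qs qs') e).
move=> q qs; rewrite mem_iota add0n ltnS /=; apply: leq_trunc_log.
have [_ a1 b1] := hs _ qs; have [a2 b2] := hH _ qs.
have : q.1 ^+ 2 <= H%:Z ^+ 2 by rewrite lerXn2r.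
have : q.2 ^+ 2 <= H%:Z ^+ 2 by rewrite lerXn2r.
have -> : H%:Z ^+ 2 = (H ^ 2)%N%:Z by rewrite expr2 -PoszM mulnn.
have := sqr_ge0 q.1; have := sqr_ge0 q.2; clear.
by move: (q.1 ^+ 2) (q.2 ^+ 2) (H ^ 2)%N => a b c; lia.
Qed.

Lemma norm_prim_size (D m : int) (H : nat) (s : seq (int * int)) :
  squarefreez D -> m != 0 -> D != 0 -> uniq s ->
  (forall p, p \in s -> [/\ p.1 ^+ 2 - D * p.2 ^+ 2 = m, 0 <= p.1 & 0 <= p.2]) ->
  (forall p, p \in s -> p.1 <= H%:Z /\ p.2 <= H%:Z) ->
  (forall p, p \in s -> coprimez p.1 p.2) ->
  (size s <= (26 + trunc_log 2 (2 * H ^ 2)) * tau `|m|)%N.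
Proof.
move=> sqD m0 D0 us hs hH hc.
case: s us hs hH hc => // p0 s0; set s := p0 :: s0 => us hs hH hc.
have p0s : p0 \in s by rewrite mem_head.
pose h (p : int * int) := `|gcdz (p.1 * p0.2 - p0.1 * p.2) m|%N.
apply: (@size_le_fibers _ _ h) => [p ps|d _].
  by rewrite -dvdn_divisors ?absz_gt0 // -dvdzE dvdz_gcdr.
apply: (norm_class_size m0 D0).
- exact: filter_uniq.
- by move=> p; rewrite mem_filter => /andP[_ /hs].
- by move=> p; rewrite mem_filter => /andP[_ /hH].
move=> p q; rewrite !mem_filter => /andP[/eqP hp ps] /andP[/eqP hq qs].
have [E0 _ _] := hs _ p0s; have [E1 _ _] := hs _ ps; have [E2 _ _] := hs _ qs.
apply: (norm_class_dvd sqD m0 E0 E1 E2 (hc _ p0s) (hc _ ps)).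
by move: hp; rewrite -hq /h /gcdz /= => ->.
Qed.

Lemma divz_le (x : int) (g : nat) : 0 <= x -> (x %/ g)%Z <= x.
Proof. by case: x => // n _; rewrite divz_nat lez_nat leq_div. Qed.

(** Dividing by the gcd [g] of the coordinates gives a primitive solution for [m / g^2], and [g]
    divides [m]; hence the second factor [T]. Since [tau] is not monotone, [T] is made to dominate
    it on the whole range up to [m]. *)
Lemma norm_nonneg_size (D m : int) (H T : nat) (s : seq (int * int)) :
  squarefreez D -> m != 0 -> D != 0 -> uniq s ->
  (forall m', (0 < m' <= `|m|)%N -> (tau m' <= T)%N) ->
  (forall p, p \in s -> [/\ p.1 ^+ 2 - D * p.2 ^+ 2 = m, 0 <= p.1 & 0 <= p.2]) ->
  (forall p, p \in s -> p.1 <= H%:Z /\ p.2 <= H%:Z) ->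
  (size s <= (26 + trunc_log 2 (2 * H ^ 2)) * T * T)%N.
Proof.
move=> sqD m0 D0 us hT hs hH.
have am0 : (0 < `|m|)%N by rewrite absz_gt0.
pose h (p : int * int) := gcdn `|p.1| `|p.2|.
have gP p : p \in s -> [/\ (0 < h p)%N, p.1 = (p.1 %/ h p)%Z * h p, p.2 = (p.2 %/ h p)%Z * h p,
    m = ((p.1 %/ h p)%Z ^+ 2 - D * (p.2 %/ h p)%Z ^+ 2) * (h p)%:Z ^+ 2 &
    coprimez (p.1 %/ h p)%Z (p.2 %/ h p)%Z].
  move=> ps; have [E _ _] := hs _ ps.
  have g0 : (0 < h p)%N.
    rewrite gcdn_gt0 !absz_gt0 -negb_and; apply: contra m0.
    by case/andP=> /eqP a /eqP b; rewrite -E a b expr0n mulr0 subrr.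
  have d1 : p.1 = (p.1 %/ h p)%Z * h p by rewrite divzK // dvdzE dvdn_gcdl.
  have d2 : p.2 = (p.2 %/ h p)%Z * h p by rewrite divzK // dvdzE dvdn_gcdr.
  split=> //; first by rewrite -E {1}d1 {1}d2; ring.
  have gn : (h p)%:Z != 0 by lia.
  rewrite /coprimez; apply/eqP/(mulIf gn); rewrite mul1r.
  by rewrite -[X in _ * X = _]/(`|(h p)%:Z|%N%:Z) mulz_gcdl -d1 -d2.
apply: leq_trans (_ : ((26 + trunc_log 2 (2 * H ^ 2)) * T * tau `|m| <= _)%N); last first.
  by rewrite leq_mul2l hT ?orbT // am0 leqnn.
apply: (@size_le_fibers _ _ h) => [p ps|g _].
  rewrite -dvdn_divisors //; have [_ _ _ -> _] := gP _ ps.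
  by rewrite -[X in (X %| _)%N]/(`|(h p)%:Z|%N) -dvdzE dvdz_mull // expr2 dvdz_mulr.
set sg := filter _ _.
have sgP p : p \in sg -> p \in s /\ h p = g by rewrite mem_filter => /andP[/eqP].
have usg : uniq sg by apply: filter_uniq.
move: sg sgP usg => sg sgP usg.
case: sg sgP usg => // q0 s0; set sg := q0 :: s0 => sgP usg.
have [q0s gq0] := sgP q0 (mem_head _ _).
have [g0 _ _ mE _] := gP _ q0s; rewrite gq0 in g0 mE.
set m' := _ - _ in mE.
have m'0 : m' != 0 by apply: contraNneq m0 => e; rewrite mE e mul0r.
have gn : g%:Z ^+ 2 != 0 by rewrite expf_eq0; lia.
pose k (p : int * int) := ((p.1 %/ g)%Z, (p.2 %/ g)%Z).
rewrite -(size_map k); apply: leq_trans (_ : _ <= (26 + trunc_log 2 (2 * H ^ 2)) * tau `|m'|)%N _; last first.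
  rewrite leq_mul2l hT ?orbT // absz_gt0 m'0 /= mE abszM.
  by rewrite leq_pmulr // absz_gt0.
apply: (norm_prim_size sqD m'0 D0).
- rewrite map_inj_in_uniq // => p q /sgP[ps hp] /sgP[qs hq] [e1 e2].
  have [_ a1 b1 _ _] := gP _ ps; have [_ a2 b2 _ _] := gP _ qs.
  rewrite hp in a1 b1; rewrite hq in a2 b2.
  by rewrite [p]surjective_pairing [q]surjective_pairing a1 a2 b1 b2 e1 e2.
- move=> _ /mapP[p /sgP[ps hp] ->]; have [_ _ _ E _] := gP _ ps.
  have [_ a b] := hs _ ps; split; rewrite /= ?divz_ge0 //.
  by apply: (mulIf gn); rewrite -mE E hp.
- move=> _ /mapP[p /sgP[ps hp] ->] /=; have [a b] := hH _ ps.
  have [_ a0 b0] := hs _ ps.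
  by split; [apply: le_trans a|apply: le_trans b]; apply: divz_le.
- by move=> _ /mapP[p /sgP[ps hp] ->]; have [_ _ _ _] := gP _ ps; rewrite hp.
Qed.

Lemma squarefree_part (D : int) : D != 0 ->
  exists D0 s, [/\ D = D0 * s%:Z ^+ 2, squarefreez D0, (0 < s)%N & (s <= `|D|)%N].
Proof.
move=> D0; have aD0 : (0 < `|D|)%N by rewrite absz_gt0.
have ex1 : exists s, (s * s %| `|D|)%N by exists 1%N.
have bnd s : (s * s %| `|D|)%N -> (s <= `|D|)%N.
  by move=> h; apply: dvdn_leq aD0 (dvdn_trans (dvdn_mulr s (dvdnn s)) h).
case: (ex_maxnP ex1 bnd) => s sD smax.
have s0 : (0 < s)%N by apply: smax; rewrite dvd1n.
have /dvdzP[E EE] : (s%:Z ^+ 2 %| D)%Z by rewrite dvdzE abszX expnS expn1.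
exists E, s; split=> //; last exact: bnd.
move=> t /dvdzP[q qE].
have t0 : t != 0 by apply: contraNneq D0 => t0; rewrite EE qE t0 !(mulr0, mul0r).
have : (`|t| * s <= s)%N.
  apply: smax; rewrite -[X in (X %| _)%N]/(`|Posz (`|t| * s * (`|t| * s))%N|%N).
  rewrite -dvdzE EE qE.
  have -> : Posz (`|t| * s * (`|t| * s))%N = `|t|%:Z ^+ 2 * s%:Z ^+ 2 by rewrite !PoszM; ring.
  rewrite dvdz_mul // dvdz_mull // -expr2.
  by rewrite dvdzE !abszX absz_nat.
have : (0 < `|t|)%N by rewrite absz_gt0.
by nia.
Qed.

(** Writing [D = D0 r^2] with [D0] squarefree moves [r <= H] into the second coordinate, whence
    [H * H] in place of [H]. The factor 4 counts the sign patterns lost under absolute values. *)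
Lemma norm_size (D m : int) (H T : nat) (s : seq (int * int)) :
  m != 0 -> D != 0 -> uniq s -> (`|D| <= H)%N ->
  (forall m', (0 < m' <= `|m|)%N -> (tau m' <= T)%N) ->
  (forall p, p \in s -> p.1 ^+ 2 - D * p.2 ^+ 2 = m) ->
  (forall p, p \in s -> `|p.1| <= H%:Z /\ `|p.2| <= H%:Z) ->
  (size s <= 4 * ((26 + trunc_log 2 (2 * (H * H) ^ 2)) * T * T))%N.
Proof.
move=> m0 Dn0 us DH hT hs hH.
have [D0 [r [DE sqD0 r0 rD]]] := squarefree_part Dn0.
have D00 : D0 != 0 by apply: contraNneq Dn0 => e; rewrite DE e mul0r.
pose h (p : int * int) : int * int := (`|p.1|, `|p.2 * r%:Z|).
apply: leq_trans (_ : _ <= 4 * size (undup (map h s)))%N _.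
  apply: (@size_le_fibers _ _ h) => [p ps|q _].
    by rewrite mem_undup map_f.
  pose k (p : int * int) := (0 <= p.1, 0 <= p.2).
  have := @size_le_inj _ _ k [seq p <- s | h p == q] [seq (b, c) | b <- [:: true; false], c <- [:: true; false]].
  apply; first exact: filter_uniq.
    move=> p p'; rewrite !mem_filter => /andP[/eqP <- ps] /andP[/eqP hp' ps'] ek.
    have e1 : (0 <= p.1) = (0 <= p'.1) := congr1 fst ek.
    have e2 : (0 <= p.2) = (0 <= p'.2) := congr1 snd ek.
    have f1 : `|p'.1| = `|p.1| := congr1 fst hp'.
    have f2 : `|p'.2 * r%:Z| = `|p.2 * r%:Z| := congr1 snd hp'.
    rewrite !normrM in f2.
    have rn : `|r%:Z| != 0 by rewrite normr_eq0; lia.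
    move/(mulIf rn): f2 => f2; clear - e1 e2 f1 f2.
    by rewrite [p]surjective_pairing [p']surjective_pairing; congr pair; lia.
  by move=> p _; apply/allpairsP; exists (k p); split=> //; case: (k p).1 (k p).2 => [] [].
rewrite leq_mul2l /=; apply: (norm_nonneg_size sqD0 m0 D00 (undup_uniq _) hT).
  move=> p; rewrite mem_undup => /mapP[q qs ->] /=; split=> //.
  by rewrite !real_normK ?num_real // -(hs _ qs) DE; ring.
move=> p; rewrite mem_undup => /mapP[q qs ->] /=.
have [a b] := hH _ qs; rewrite PoszM; split; last first.
  by rewrite normrM ler_pM //; clear - rD DH; lia.
by rewrite -[`|q.1|]mulr1 ler_pM //; clear - r0 rD DH; lia.
Qed.

Lemma expn_root_le (a k j C Y : nat) : (0 < j)%N ->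
  (a ^ (k * j) <= C * Y ^ j)%N -> (a ^ k <= C * Y)%N.
Proof.
move=> j0 h; rewrite -(@leq_exp2r _ _ j) // -expnM.
apply: leq_trans h _; rewrite expnMn leq_mul2r; apply/orP; right.
by case: C => [//|C]; rewrite -[X in (X <= _)%N]expn1 leq_pexp2l.
Qed.

Lemma norm_size_pow (k r : nat) : (0 < k)%N -> (0 < r)%N -> exists C : nat,
  forall (Y : nat) (D m : int) (s : seq (int * int)),
  m != 0 -> D != 0 -> uniq s -> (0 < Y)%N ->
  (`|D| <= Y ^ r)%N -> (`|m| <= Y ^ r)%N ->
  (forall p, p \in s -> p.1 ^+ 2 - D * p.2 ^+ 2 = m) ->
  (forall p, p \in s -> `|p.1| <= (Y ^ r)%N%:Z /\ `|p.2| <= (Y ^ r)%N%:Z) ->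
  (size s ^ k <= C * Y)%N.
Proof.
(* In the [K]-th power the logarithm costs [Y ^ (4 * r)] and each of the two divisor counts costs
   [Y ^ r]; the total [Y ^ (6 * r)] is removed by a root of order [6 * r]. *)
move=> k0 r0; pose K := (k * (6 * r))%N.
have K0 : (0 < K)%N by rewrite !muln_gt0 k0 r0.
have [C1 hC1] := tau_bound K0.
exists (4 ^ K * (26 ^ K * K ^ K * 2) * C1 * C1)%N => Y D m s m0 D0 us Y0 DY mY hs hH.
apply: (@expn_root_le _ _ (6 * r)); first by rewrite muln_gt0 r0.
(* The index 0 is masked because the divisor bound asks for a positive argument. *)
pose T := (\max_(i < `|m|.+1) if (i : nat) == 0 then 0 else tau i)%N.
have TK : (T ^ K <= C1 * Y ^ r)%N.
  rewrite /T; elim/big_ind: _ => [|x y hx hy|i _]; first by rewrite exp0n.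
    by case: (leqP x y).
  case: eqP => [_|/eqP i0]; first by rewrite exp0n.
  apply: leq_trans (hC1 _ _) _; first by rewrite lt0n.
  by rewrite leq_mul2l (leq_trans _ mY) ?orbT // -ltnS.
have hT m' : (0 < m' <= `|m|)%N -> (tau m' <= T)%N.
  case/andP=> m'0 m'm; rewrite -ltnS in m'm.
  have := @leq_bigmax _ (fun i : 'I_(`|m|.+1) => if (i : nat) == 0%N then 0%N else tau i) (Ordinal m'm).
  by rewrite /= -[m' == 0%N]negbK -lt0n m'0.
have := norm_size m0 D0 us DY hT hs hH.
set t := trunc_log 2 _ => hsz.
have tE : (2 ^ t <= 2 * Y ^ (4 * r))%N.
  have -> : (Y ^ (4 * r) = (Y ^ r * Y ^ r) ^ 2)%N.
    by rewrite -expnD -expnM; congr (_ ^ _)%N; lia.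
  by apply: trunc_logP => //; rewrite muln_gt0 expn_gt0 muln_gt0 expn_gt0 Y0.
(* The inequality used for exponents of primes also absorbs the [K]-th power of the logarithm [t],
   at the price of [2 ^ t], which is polynomial in [Y]. *)
have LK : ((26 + t) ^ K <= 26 ^ K * K ^ K * 2 * Y ^ (4 * r))%N.
  apply: leq_trans (_ : (26 * t.+1) ^ K <= _)%N; first by rewrite leq_exp2r //; lia.
  rewrite expnMn -!mulnA leq_mul2l; apply/orP; right.
  by apply: leq_trans (expn_succ_le _ K0) _; rewrite leq_mul2l tE orbT.
apply: leq_trans (_ : (4 * ((26 + t) * T * T)) ^ K <= _)%N; first by rewrite leq_exp2r.
rewrite 3![in X in (X <= _)%N]expnMn.
have -> : (Y ^ (6 * r) = Y ^ (4 * r) * Y ^ r * Y ^ r)%N by rewrite -!expnD; congr (_ ^ _)%N; lia.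
move: LK TK; clear; move: (26 ^ K * K ^ K * 2)%N => A.
move: ((26 + t) ^ K)%N (T ^ K)%N (4 ^ K)%N (Y ^ (4 * r))%N (Y ^ r)%N => a b c d e h1 h2.
have -> : (c * A * C1 * C1 * (d * e * e) = c * ((A * d) * (C1 * e) * (C1 * e)))%N by ring.
by rewrite !leq_mul.
Qed.

(** * Integer points of conics *)

Section Conic.
Variable R : comNzRingType.
Implicit Types a b c d e g x y : R.

Definition conic a b c d e g x y :=
  a * x ^+ 2 + b * x * y + c * y ^+ 2 + d * x + e * y + g.

Definition qform a b c x y := a * x ^+ 2 + b * x * y + c * y ^+ 2.

Definition qdisc a b c := b ^+ 2 - 4%:R * a * c.

(** The determinant of the symmetric matrix ((2a, b, d), (b, 2c, e), (d, e, 2g)) of the homogenised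
    conic is -2 times this expression. *)
Definition cdisc a b c d e g :=
  a * e ^+ 2 - b * d * e + c * d ^+ 2 + qdisc a b c * g.

(** Completing the square in [x] and then in [y]. On the conic this is a norm equation with
    right-hand side [4 a cdisc], nonzero when [a] is nonzero and the conic is nonsingular in
    characteristic other than 2. *)
Lemma conic_norm a b c d e g x y :
  (qdisc a b c * y + (b * d - 2%:R * a * e)) ^+ 2
    - qdisc a b c * (2%:R * a * x + b * y + d) ^+ 2
  = 4%:R * a * cdisc a b c d e g
    - 4%:R * a * qdisc a b c * conic a b c d e g x y.
Proof. by rewrite /conic /cdisc /qdisc; ring. Qed.

End Conic.

Section Heights.
Variables (Y : nat) (Y4 : (4 <= Y)%N).

(** Because [Y >= 4], a sum costs a single exponent and the constants 2 and 4 have exponent 1, so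
    polynomial bounds are tracked by exponents alone. *)
Lemma height_add (i j l : nat) (x y : int) : (i < l)%N -> (j < l)%N ->
  `|x| <= (Y ^ i)%N%:Z -> `|y| <= (Y ^ j)%N%:Z -> `|x + y| <= (Y ^ l)%N%:Z.
Proof.
case: l => // l; rewrite !ltnS => il jl hx hy.
have h1 : (Y ^ i <= Y ^ l)%N by rewrite leq_pexp2l //; lia.
have h2 : (Y ^ j <= Y ^ l)%N by rewrite leq_pexp2l //; lia.
have h3 : (2 * Y ^ l <= Y ^ l.+1)%N by rewrite expnS leq_mul2r; lia.
by apply: le_trans (ler_normD _ _) _; lia.
Qed.

Lemma height_sub (i j l : nat) (x y : int) : (i < l)%N -> (j < l)%N ->
  `|x| <= (Y ^ i)%N%:Z -> `|y| <= (Y ^ j)%N%:Z -> `|x - y| <= (Y ^ l)%N%:Z.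
Proof. by move=> il jl hx hy; apply: (height_add il jl hx); rewrite normrN. Qed.

Lemma height_mul (i j l : nat) (x y : int) : (i + j <= l)%N ->
  `|x| <= (Y ^ i)%N%:Z -> `|y| <= (Y ^ j)%N%:Z -> `|x * y| <= (Y ^ l)%N%:Z.
Proof.
move=> ijl hx hy; apply: le_trans (_ : _ <= (Y ^ (i + j))%N%:Z) _.
  by rewrite expnD PoszM normrM ler_pM.
by rewrite lez_nat leq_pexp2l //; lia.
Qed.

Lemma height_sqr (i l : nat) (x : int) : (i + i <= l)%N ->
  `|x| <= (Y ^ i)%N%:Z -> `|x ^+ 2| <= (Y ^ l)%N%:Z.
Proof. by move=> il hx; rewrite expr2; exact: (height_mul il hx hx). Qed.

Lemma height2 : `|2%:R : int| <= (Y ^ 1)%N%:Z. Proof. by rewrite expn1; lia. Qed.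
Lemma height4 : `|4%:R : int| <= (Y ^ 1)%N%:Z. Proof. by rewrite expn1; lia. Qed.

End Heights.

Lemma int_conic_size (k r : nat) : (0 < k)%N -> (0 < r)%N -> exists C : nat,
  forall (Y : nat) (a b c d e g : int) (s : seq (int * int)),
  (4 <= Y)%N -> a != 0 -> qdisc a b c != 0 -> cdisc a b c d e g != 0 ->
  `|a| <= (Y ^ r)%N%:Z -> `|b| <= (Y ^ r)%N%:Z -> `|c| <= (Y ^ r)%N%:Z ->
  `|d| <= (Y ^ r)%N%:Z -> `|e| <= (Y ^ r)%N%:Z -> `|g| <= (Y ^ r)%N%:Z ->
  uniq s ->
  (forall p, p \in s -> conic a b c d e g p.1 p.2 = 0) ->
  (forall p, p \in s -> `|p.1| <= (Y ^ r)%N%:Z /\ `|p.2| <= (Y ^ r)%N%:Z) ->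
  (size s ^ k <= C * Y)%N.
Proof.
(* The largest quantity is [4 a cdisc], of exponent at most [(r + 1) + (4 * r + 7)]. *)
move=> k0 r0; have r9 : (0 < 5 * r + 9)%N by lia.
have [C hC] := norm_size_pow k0 r9.
exists C => Y a b c d e g s Y4 a0 D0 T0 ha hb hc hd he hg us hs hH.
pose h (p : int * int) := (qdisc a b c * p.2 + (b * d - 2%:R * a * e),
                           2%:R * a * p.1 + b * p.2 + d).
have hDb : `|qdisc a b c| <= (Y ^ (2 * r + 2))%N%:Z.
  apply: (@height_sub _ Y4 (2 * r) (2 * r + 1)); [clear; lia|clear; lia| |].
    by apply: (height_sqr Y4 _ hb); lia.
  apply: (@height_mul _ Y4 (r + 1) r _ _ _ _ _ hc); first by lia.
  by apply: (height_mul Y4 _ (height4 Y4) ha); lia.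
have hbd : `|b * d - 2%:R * a * e| <= (Y ^ (2 * r + 2))%N%:Z.
  apply: (@height_sub _ Y4 (2 * r) (2 * r + 1)); [clear; lia|clear; lia| |].
    by apply: (height_mul Y4 _ hb hd); lia.
  apply: (@height_mul _ Y4 (r + 1) r _ _ _ _ _ he); first by lia.
  by apply: (height_mul Y4 _ (height2 Y4) ha); lia.
rewrite -(size_map h).
apply: (hC Y (qdisc a b c) (4%:R * a * cdisc a b c d e g)) => //.
- by rewrite !mulf_neq0.
- rewrite map_inj_in_uniq // => p q _ _ [].
  move=> /addIr/(mulfI D0) e2; rewrite e2 => /addIr/addIr.
  have n2 : 2%:R * a != 0 by rewrite mulf_neq0.
  by move/(mulfI n2) => e1; rewrite [p]surjective_pairing e1 e2 -surjective_pairing.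
- by lia.
- rewrite -lez_nat abszE; apply: le_trans hDb _.
  by rewrite lez_nat leq_pexp2l //; lia.
- rewrite -lez_nat abszE.
  apply: (@height_mul _ Y4 (r + 1) (4 * r + 7)); first by lia.
    by apply: (height_mul Y4 _ (height4 Y4) ha); lia.
  apply: (@height_add _ Y4 (3 * r + 3) (4 * r + 6)); [clear; lia|clear; lia| |].
    apply: (@height_add _ Y4 (3 * r + 2) (3 * r)); [clear; lia|clear; lia| |].
      apply: (@height_sub _ Y4 (3 * r) (3 * r)); [clear; lia|clear; lia| |].
        by apply: (height_mul Y4 _ ha (height_sqr Y4 (leqnn _) he)); lia.
      by apply: (height_mul Y4 _ (height_mul Y4 (leqnn _) hb hd) he); lia.
    by apply: (height_mul Y4 _ hc (height_sqr Y4 (leqnn _) hd)); lia.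
  by apply: (height_mul Y4 _ hDb hg); lia.
- move=> _ /mapP[p ps ->] /=.
  by rewrite (conic_norm _ _ _ _ _ g) (hs _ ps) mulr0 subr0.
- move=> _ /mapP[p ps ->] /=; have [h1 h2] := hH _ ps; split.
    apply: (@height_add _ Y4 (3 * r + 2) (2 * r + 2)); [clear; lia|clear; lia| |].
      by apply: (height_mul Y4 _ hDb h2); lia.
    exact: hbd.
  apply: (@height_add _ Y4 (2 * r + 2) r) ; [clear; lia|clear; lia| |exact: hd].
  apply: (@height_add _ Y4 (2 * r + 1) (2 * r)); [clear; lia|clear; lia| |].
    by apply: (height_mul Y4 _ (height_mul Y4 (leqnn _) (height2 Y4) ha) h1); lia.
  by apply: (height_mul Y4 _ hb h2); lia.
Qed.

(** * Chords of a nonsingular conic *)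

Section Chords.
Variables (F : fieldType) (a b c d e g : F).
Hypothesis T0 : cdisc a b c d e g != 0.
Local Notation f := (conic a b c d e g).
Local Notation q := (qform a b c).

(** If the direction [w] of a chord were isotropic, the gradient [(d', e')] at the first point would
    be orthogonal to [w], and [w] would be parallel to [(e', - d')]. But [cdisc] equals the
    quadratic form at [(e', - d')], once the origin is moved to a point of the conic, and would
    vanish. *)
Lemma conic_chord (x1 y1 x2 y2 : F) :
  f x1 y1 = 0 -> f x2 y2 = 0 -> (x1, y1) != (x2, y2) -> q (x2 - x1) (y2 - y1) != 0.
Proof.
move=> E1 E2 ne; apply: contra T0 => /eqP Eq.
set w1 := x2 - x1 in Eq *; set w2 := y2 - y1 in Eq *.
pose d' := 2%:R * a * x1 + b * y1 + d; pose e' := b * x1 + 2%:R * c * y1 + e.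
have El : d' * w1 + e' * w2 = 0.
  transitivity (f x2 y2 - f x1 y1 - q w1 w2); last by rewrite E1 E2 Eq !subr0.
  by rewrite /d' /e' /w1 /w2 /qform /conic; ring.
have ET : cdisc a b c d e g = a * e' ^+ 2 - b * d' * e' + c * d' ^+ 2.
  transitivity (a * e' ^+ 2 - b * d' * e' + c * d' ^+ 2 + qdisc a b c * f x1 y1).
    by rewrite /cdisc /qdisc /d' /e' /conic; ring.
  by rewrite E1 mulr0 addr0.
have : (w1 != 0) || (w2 != 0).
  rewrite -negb_and; apply: contra ne; rewrite !subr_eq0 => /andP[/eqP-> /eqP->].
  by [].
case/orP=> wn.
  have wn2 : w1 ^+ 2 != 0 by rewrite expf_neq0.
  rewrite -(inj_eq (mulfI wn2)) mulr0 ET.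
  have -> : w1 ^+ 2 * (a * e' ^+ 2 - b * d' * e' + c * d' ^+ 2) =
     e' ^+ 2 * qform a b c w1 w2
     + (c * (d' * w1 - e' * w2) - b * e' * w1) * (d' * w1 + e' * w2).
    by rewrite /qform; ring.
  by rewrite El Eq !mulr0 addr0.
have wn2 : w2 ^+ 2 != 0 by rewrite expf_neq0.
rewrite -(inj_eq (mulfI wn2)) mulr0 ET.
have -> : w2 ^+ 2 * (a * e' ^+ 2 - b * d' * e' + c * d' ^+ 2) =
   d' ^+ 2 * qform a b c w1 w2
   + (a * (e' * w2 - d' * w1) - b * d' * w2) * (d' * w1 + e' * w2).
  by rewrite /qform; ring.
by rewrite El Eq !mulr0 addr0.
Qed.

Lemma conic_noncollinear (x1 y1 x2 y2 x3 y3 : F) :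
  f x1 y1 = 0 -> f x2 y2 = 0 -> f x3 y3 = 0 ->
  (x1, y1) != (x2, y2) -> (x1, y1) != (x3, y3) -> (x2, y2) != (x3, y3) ->
  (x2 - x1) * (y3 - y1) - (y2 - y1) * (x3 - x1) != 0.
Proof.
move=> E1 E2 E3 n12 n13 n23.
have q12 := conic_chord E1 E2 n12; have q13 := conic_chord E1 E3 n13.
have q23 := conic_chord E2 E3 n23.
pose d' := 2%:R * a * x1 + b * y1 + d; pose e' := b * x1 + 2%:R * c * y1 + e.
set p1 := x2 - x1 in q12 *; set p2 := y2 - y1 in q12 *.
set r1 := x3 - x1 in q13 *; set r2 := y3 - y1 in q13 *.
have lp : d' * p1 + e' * p2 = - q p1 p2.
  transitivity (f x2 y2 - f x1 y1 - q p1 p2); last by rewrite E1 E2 !sub0r oppr0 add0r.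
  by rewrite /d' /e' /p1 /p2 /qform /conic; ring.
have lr : d' * r1 + e' * r2 = - q r1 r2.
  transitivity (f x3 y3 - f x1 y1 - q r1 r2); last by rewrite E1 E3 !sub0r oppr0 add0r.
  by rewrite /d' /e' /r1 /r2 /qform /conic; ring.
apply/eqP => det0.
have dt : p1 * r2 = p2 * r1 by apply/eqP; rewrite -subr_eq0 det0.
(* [r = l p] makes [q r = l^2 q p], while the linear parts force [q r = l q p] *)
have [l [r1E r2E]] : exists l, r1 = l * p1 /\ r2 = l * p2.
  have [p10|p1n] := eqVneq p1 0; last first.
    exists (r1 / p1); rewrite divfK //; split=> //.
    by apply: (mulfI p1n); rewrite dt; field.
  have [p20|p2n] := eqVneq p2 0.
    by move: q12; rewrite p10 p20 /qform !(mulr0, expr0n) /= !(addr0, mulr0) eqxx.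
  exists (r2 / p2); rewrite divfK //; split=> //.
  by apply: (mulfI p2n); rewrite -dt p10 !(mul0r, mulr0).
have : l * (l - 1) * q p1 p2 = 0.
  transitivity (q r1 r2 - l * q p1 p2); first by rewrite r1E r2E /qform; ring.
  rewrite -[q r1 r2]opprK -lr -[q p1 p2]opprK -lp r1E r2E; ring.
move/eqP; rewrite !mulf_eq0 (negPf q12) orbF => /orP[/eqP l0|].
  by move: q13; rewrite r1E r2E l0 /qform !mul0r !(mulr0, expr0n) /= !(addr0, mulr0) eqxx.
rewrite subr_eq0 => /eqP l1; move: q23.
have -> : x3 - x2 = r1 - p1 by rewrite /r1 /p1; ring.
have -> : y3 - y2 = r2 - p2 by rewrite /r2 /p2; ring.
by rewrite r1E r2E l1 !mul1r !subrr /qform !(mulr0, expr0n) /= !(addr0, mulr0) eqxx.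
Qed.

End Chords.

Definition det2 (R : comNzRingType) (p r : R * R) : R := p.1 * r.2 - p.2 * r.1.

(* In the frame of three of its points a conic has only three free coefficients, so two
   more points determine it, with integers polynomially bounded in the points. *)
Lemma conic_in_frame (R : comNzRingType) (a b c d e g : R) (p1 p2 p3 p : R * R) :
  let f (p : R * R) := conic a b c d e g p.1 p.2 in
  let u := p2 - p1 in let v := p3 - p1 in
  let x := det2 (p - p1) v in let y := det2 u (p - p1) in
  let D := det2 u v in
  f p1 = 0 -> f p2 = 0 -> f p3 = 0 -> f p = 0 ->
  qform a b c u.1 u.2 * (x ^+ 2 - D * x)
  + (2%:R * a * u.1 * v.1 + b * (u.1 * v.2 + u.2 * v.1) + 2%:R * c * u.2 * v.2) * (x * y)
  + qform a b c v.1 v.2 * (y ^+ 2 - D * y) = 0.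
Proof.
move=> f u v x y D E1 E2 E3 E.
transitivity (D ^+ 2 * (f p - f p1) + D * x * (f p1 - f p2) + D * y * (f p1 - f p3)).
  by rewrite /x /y /D /u /v /f /det2 /conic /qform /=; ring.
by rewrite E1 E2 E3 E !subrr !mulr0 !addr0.
Qed.

(** A basis of the conics through [(0, 0)], [(D, 0)] and [(0, D)], which are the scaled coordinates
    of the three frame points; the scaling by [D] avoids denominators. *)
Definition frame_vec (R : comNzRingType) (D : R) (xy : R * R) : R * R * R :=
  (xy.1 ^+ 2 - D * xy.1, xy.1 * xy.2, xy.2 ^+ 2 - D * xy.2).

Definition cross (R : comNzRingType) (v w : R * R * R) : R * R * R :=
  (v.1.2 * w.2 - v.2 * w.1.2, v.2 * w.1.1 - v.1.1 * w.2, v.1.1 * w.1.2 - v.1.2 * w.1.1).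

(** Over a field, a vector orthogonal to two independent vectors is a multiple of their cross
    product. The proportion is cross-multiplied so that it makes sense in a ring. *)
Lemma cross_proportional (R : comNzRingType) (v w : R * R * R) (a b c : R) :
  a * v.1.1 + b * v.1.2 + c * v.2 = 0 -> a * w.1.1 + b * w.1.2 + c * w.2 = 0 ->
  a * (cross v w).2 = c * (cross v w).1.1 /\ b * (cross v w).2 = c * (cross v w).1.2.
Proof.
case: v w => [[v1 v2] v3] [[w1 w2] w3] /= Ev Ew.
split; apply/eqP; rewrite -subr_eq0; apply/eqP.
  transitivity (w2 * (a * v1 + b * v2 + c * v3) - v2 * (a * w1 + b * w2 + c * w3)); first by ring.
  by rewrite Ev Ew !mulr0 subrr.
transitivity (v1 * (a * w1 + b * w2 + c * w3) - w1 * (a * v1 + b * v2 + c * v3)); first by ring.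
by rewrite Ev Ew !mulr0 subrr.
Qed.

Definition qpt (p : int * int) : rat * rat := (p.1%:~R, p.2%:~R).

Lemma qptB p q : qpt (p - q) = qpt p - qpt q.
Proof. by rewrite /qpt /= !intrB. Qed.

Lemma det2_qpt p q : det2 (qpt p) (qpt q) = (det2 p q)%:~R.
Proof. by rewrite /det2 /= intrB !intrM. Qed.

Lemma qpt_inj : injective qpt.
Proof. by move=> [p1 p2] [q1 q2] [] /intr_inj -> /intr_inj ->. Qed.

Lemma frame_vec_intr (D : int) (h : int * int) :
  [/\ (frame_vec D h).1.1%:~R = h.1%:~R ^+ 2 - D%:~R * h.1%:~R :> rat,
      (frame_vec D h).1.2%:~R = h.1%:~R * h.2%:~R :> rat &
      (frame_vec D h).2%:~R = h.2%:~R ^+ 2 - D%:~R * h.2%:~R :> rat].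
Proof. by rewrite /frame_vec /= !intrB !intrM. Qed.

Section Proportional.
Variables (a b c : rat) (w1 w2 w3 D : int).
Hypotheses (aW : a * w3%:~R = c * w1%:~R) (bW : b * w3%:~R = c * w2%:~R).

(** The discriminant of the integral frame conic factors as [D^2 w1 w3 (w1 + w3 - w2)]. Up to
    proportionality its last three factors are the values [a], [c] and [a + c - b] of the quadratic
    form on the three sides of the frame triangle. *)
Lemma proportional_disc : a != 0 -> qdisc a b c != 0 -> a + c - b != 0 ->
  w3 != 0 -> D != 0 ->
  [/\ w1 != 0, qdisc w1 w2 w3 != 0 &
      cdisc w1 w2 w3 (- D * w1) (- D * w3) 0 != 0].
Proof.
move=> a0 D0 s0 W3 Dn0; have W3q : w3%:~R != 0 :> rat by rewrite intr_eq0.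
have W1 : w1 != 0.
  rewrite -(intr_eq0 rat); apply: contraNneq a0 => e0.
  by rewrite -(inj_eq (mulIf W3q)) aW e0 mulr0 mul0r.
split=> //.
  rewrite -(intr_eq0 rat); apply: contraNneq D0 => e0.
  have : c ^+ 2 * (qdisc w1 w2 w3)%:~R = w3%:~R ^+ 2 * qdisc a b c.
    have -> : (qdisc w1 w2 w3)%:~R = w2%:~R ^+ 2 - 4%:R * w1%:~R * w3%:~R :> rat.
      by rewrite /qdisc intrB !intrM.
    transitivity ((c * w2%:~R) ^+ 2 - 4%:R * (c * w1%:~R) * (c * w3%:~R)); first by ring.
    by rewrite -aW -bW /qdisc; ring.
  rewrite e0 mulr0 => /esym/eqP; rewrite mulf_eq0 expf_eq0 /= (negPf W3q).
  by [].
have -> : cdisc w1 w2 w3 (- D * w1) (- D * w3) 0 =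
   D ^+ 2 * w1 * w3 * (w1 + w3 - w2) by rewrite /cdisc; ring.
have sn : w1 + w3 - w2 != 0.
  rewrite -(intr_eq0 rat); apply: contraNneq s0 => e0.
  have : (a + c - b) * w3%:~R = c * (w1 + w3 - w2)%:~R.
    by rewrite !(mulrBl, mulrDl) aW bW intrB intrD; ring.
  by rewrite e0 mulr0 => /eqP; rewrite mulf_eq0 (negPf W3q) orbF.
by rewrite mulf_neq0 // mulf_neq0 // mulf_neq0 // expf_neq0.
Qed.

Lemma proportional_conic (h : int * int) : c != 0 ->
  let v := frame_vec D h in
  a * v.1.1%:~R + b * v.1.2%:~R + c * v.2%:~R = 0 ->
  conic w1 w2 w3 (- D * w1) (- D * w3) 0 h.1 h.2 = 0.
Proof.
move=> c0 v E; apply/eqP; rewrite -(intr_eq0 rat) -(inj_eq (mulfI c0)) mulr0.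
have -> : conic w1 w2 w3 (- D * w1) (- D * w3) 0 h.1 h.2 =
   w1 * v.1.1 + w2 * v.1.2 + w3 * v.2.
  by rewrite /conic /v /frame_vec /=; ring.
move: v.1.1 v.1.2 v.2 E => x y z E.
rewrite !(intrD, intrM) !mulrDr !mulrA -aW -bW; apply/eqP.
transitivity ((a * x%:~R + b * y%:~R + c * z%:~R) * w3%:~R); first by ring.
by rewrite E mul0r.
Qed.

End Proportional.

Lemma conic_size (k : nat) : (0 < k)%N -> exists C : nat,
  forall (a b c d e g : rat) (N : nat) (s : seq (int * int)),
  (0 < N)%N -> qdisc a b c != 0 -> cdisc a b c d e g != 0 -> uniq s ->
  (forall p, p \in s -> conic a b c d e g p.1%:~R p.2%:~R = 0) ->
  (forall p, p \in s -> `|p.1| <= N%:Z /\ `|p.2| <= N%:Z) ->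
  (size s ^ k <= C * N)%N.
Proof.
(* In base [4 * N] the coordinates have exponent 3, the frame vectors 7, their cross product 15 and
   the linear coefficients 18, all below 20. *)
move=> k0; have [C hC] := @int_conic_size k 20 k0 isT.
(* The term [4 ^ k] covers lists of at most four points; the factor 4 comes from the base
   [4 * N]. *)
exists (4 ^ k + C * 4)%N => a b c d e g N s N0 D0 T0 us hs hN.
have [s4|] := leqP (size s) 4.
  apply: leq_trans (_ : 4 ^ k <= _)%N; first by rewrite leq_exp2r.
  by rewrite mulnDl; apply: leq_trans (leq_pmulr _ N0) (leq_addr _ _).
case: s us hs hN => [//|p1 [//|p2 [//|p3 [//|p4 [//|p5 s']]]]].
set s := [:: p1, p2, p3, p4, p5 & s'] => us hs hN _.
have [i1 i2 i3 i4 i5] : [/\ p1 \in s, p2 \in s, p3 \in s, p4 \in s & p5 \in s].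
  by rewrite /s !inE !eqxx !orbT.
have [n12 n13 n23] : [/\ p1 != p2, p1 != p3 & p2 != p3].
  by move: us; rewrite /s /= !inE !negb_or -!andbA; do ![case/andP=> ?] => *; split.
have [n14 n15 n24 n25] : [/\ p1 != p4, p1 != p5, p2 != p4 & p2 != p5].
  by move: us; rewrite /s /= !inE !negb_or -!andbA; do ![case/andP=> ?] => *; split.
have [n34 n35 n45] : [/\ p3 != p4, p3 != p5 & p4 != p5].
  by move: us; rewrite /s /= !inE !negb_or -!andbA; do ![case/andP=> ?] => *; split.
have chord p q : p \in s -> q \in s -> p != q ->
    qform a b c (qpt q - qpt p).1 (qpt q - qpt p).2 != 0.
  move=> ps qs npq; apply: (conic_chord T0 (hs _ ps) (hs _ qs)).
  by rewrite -!/(qpt _) (inj_eq qpt_inj).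
have noncol p q r : p \in s -> q \in s -> r \in s -> p != q -> p != r -> q != r ->
    det2 (q - p) (r - p) != 0.
  move=> ps qs rs npq npr nqr; rewrite -(intr_eq0 rat) -det2_qpt !qptB.
  by apply: (conic_noncollinear T0 (hs _ ps) (hs _ qs) (hs _ rs)); rewrite -!/(qpt _) (inj_eq qpt_inj).
pose u := p2 - p1; pose v := p3 - p1; pose D := det2 u v.
pose h p := (det2 (p - p1) v, det2 u (p - p1)).
pose V p := frame_vec D (h p).
pose W := cross (V p4) (V p5).
pose qu := qpt u; pose qv := qpt v.
pose a' := qform a b c qu.1 qu.2; pose c' := qform a b c qv.1 qv.2.
pose b' := 2%:R * a * qu.1 * qv.1 + b * (qu.1 * qv.2 + qu.2 * qv.1) + 2%:R * c * qu.2 * qv.2.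
have frame p : p \in s ->
    a' * (V p).1.1%:~R + b' * (V p).1.2%:~R + c' * (V p).2%:~R = 0.
  move=> ps.
  have := @conic_in_frame _ a b c d e g (qpt p1) (qpt p2) (qpt p3) (qpt p)
    (hs _ i1) (hs _ i2) (hs _ i3) (hs _ ps).
  rewrite -!qptB !det2_qpt => E.
  by have [-> -> ->] := frame_vec_intr D (h p); exact: E.
have D_neq0 : D != 0 by apply: noncol.
have a'0 : a' != 0 by rewrite /a' /qu qptB; apply: chord.
have c'0 : c' != 0 by rewrite /c' /qv qptB; apply: chord.
(* This is the quadratic form on the third side [p3 - p2] of the frame triangle. *)
have uv0 : a' + c' - b' != 0.
  have := chord _ _ i2 i3 n23; rewrite (_ : qpt p3 - qpt p2 = qv - qu).
    by congr (_ != _); rewrite /a' /b' /c' /qform /=; ring.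
  by rewrite /qu /qv !qptB opprB addrA subrK.
have disc' : qdisc a' b' c' = D%:~R ^+ 2 * qdisc a b c.
  by rewrite /D -det2_qpt /qdisc /a' /b' /c' /det2 /qform -/qu -/qv; ring.
(* The third coordinate of the cross product splits into the determinants of the triples (1, 3, 4),
   (1, 3, 5), (1, 2, 3) and (2, 4, 5) of the five points, none of which is collinear. *)
have W3 : W.2 != 0.
  have -> : W.2 = (h p4).1 * (h p5).1 * (D * det2 (p4 - p2) (p5 - p2)).
    by rewrite /W /V /h /D /cross /frame_vec /det2 /u /v /=; ring.
  have h1 p : p \in s -> p1 != p -> p3 != p -> (h p).1 != 0.
    by move=> ps n1 n3; apply: noncol => //; rewrite eq_sym.
  apply: mulf_neq0; first by apply: mulf_neq0; apply: h1.
  by apply: mulf_neq0 => //; apply: noncol.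
have W3q : W.2%:~R != 0 :> rat by rewrite intr_eq0.
pose Vq p : rat * rat * rat := ((V p).1.1%:~R, (V p).1.2%:~R, (V p).2%:~R).
have [] := @cross_proportional _ (Vq p4) (Vq p5) a' b' c' (frame _ i4) (frame _ i5).
rewrite /cross /= -!intrM -!intrB => aW bW.
have {}aW : a' * W.2%:~R = c' * W.1.1%:~R by exact: aW.
have {}bW : b' * W.2%:~R = c' * W.1.2%:~R by exact: bW.
have disc'0 : qdisc a' b' c' != 0.
  by rewrite disc' mulf_neq0 // expf_neq0 // intr_eq0.
have [W1 DW TW] := proportional_disc aW bW a'0 disc'0 uv0 W3 D_neq0.
have onW p : p \in s -> conic W.1.1 W.1.2 W.2 (- D * W.1.1) (- D * W.2) 0 (h p).1 (h p).2 = 0.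
  by move=> /frame; apply: (proportional_conic aW bW c'0).
pose Y := (4 * N)%N; have Y4 : (4 <= Y)%N by rewrite leq_pmulr.
have hY (x y : int) : `|x| <= N%:Z -> `|y| <= N%:Z -> `|x - y| <= (Y ^ 1)%N%:Z.
  by move=> hx hy; rewrite expn1 /Y; clear - hx hy; lia.
have dif p q : p \in s -> q \in s ->
    `|(p - q).1| <= (Y ^ 1)%N%:Z /\ `|(p - q).2| <= (Y ^ 1)%N%:Z.
  by move=> /hN[a1 b1] /hN[a2 b2]; split; apply: hY.
have hdet (p q : int * int) : `|p.1| <= (Y ^ 1)%N%:Z /\ `|p.2| <= (Y ^ 1)%N%:Z ->
    `|q.1| <= (Y ^ 1)%N%:Z /\ `|q.2| <= (Y ^ 1)%N%:Z -> `|det2 p q| <= (Y ^ 3)%N%:Z.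
  move=> [a1 b1] [a2 b2]; apply: (@height_sub _ Y4 2 2) => //.
    exact: (@height_mul _ Y4 1 1).
  exact: (@height_mul _ Y4 1 1).
have hD : `|D| <= (Y ^ 3)%N%:Z by apply: hdet; apply: dif.
have hh p : p \in s -> `|(h p).1| <= (Y ^ 3)%N%:Z /\ `|(h p).2| <= (Y ^ 3)%N%:Z.
  by move=> ps; split; apply: hdet; apply: dif.
have hV p : p \in s -> [/\ `|(V p).1.1| <= (Y ^ 7)%N%:Z, `|(V p).1.2| <= (Y ^ 7)%N%:Z &
    `|(V p).2| <= (Y ^ 7)%N%:Z].
  move=> /hh[h1 h2]; split.
  - apply: (@height_sub _ Y4 6 6) => //; first exact: (height_sqr Y4 _ h1).
    exact: (height_mul Y4 _ hD h1).
  - exact: (height_mul Y4 _ h1 h2).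
  - apply: (@height_sub _ Y4 6 6) => //; first exact: (height_sqr Y4 _ h2).
    exact: (height_mul Y4 _ hD h2).
have [v1 v2 v3] := hV _ i4; have [w1 w2 w3] := hV _ i5.
have hc x y z t : `|x| <= (Y ^ 7)%N%:Z -> `|y| <= (Y ^ 7)%N%:Z -> `|z| <= (Y ^ 7)%N%:Z ->
    `|t| <= (Y ^ 7)%N%:Z -> `|x * y - z * t| <= (Y ^ 15)%N%:Z.
  move=> hx hy hz ht; apply: (@height_sub _ Y4 14 14) => //.
    exact: (height_mul Y4 _ hx hy).
  exact: (height_mul Y4 _ hz ht).
have W1b : `|W.1.1| <= (Y ^ 15)%N%:Z by apply: hc.
have W2b : `|W.1.2| <= (Y ^ 15)%N%:Z by apply: hc.
have W3b : `|W.2| <= (Y ^ 15)%N%:Z by apply: hc.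
have up i x : (i <= 20)%N -> `|x| <= (Y ^ i)%N%:Z -> `|x| <= (Y ^ 20)%N%:Z.
  by move=> i20 /le_trans; apply; rewrite lez_nat leq_pexp2l // (leq_trans _ Y4).
have hND : `|- D| <= (Y ^ 3)%N%:Z by rewrite normrN.
rewrite -(size_map h) mulnDl; apply: leq_trans (leq_addl _ _).
rewrite -mulnA -/Y.
apply: (hC Y _ _ _ _ _ _ (map h s) Y4 W1 DW TW).
- exact: up W1b.
- exact: up W2b.
- exact: up W3b.
- exact: (height_mul Y4 _ hND W1b).
- exact: (height_mul Y4 _ hND W3b).
- by rewrite normr0.
- rewrite map_inj_in_uniq // => p q _ _ hpq.
  have e1 : det2 (p - p1) v = det2 (q - p1) v := congr1 fst hpq.
  have e2 : det2 u (p - p1) = det2 u (q - p1) := congr1 snd hpq.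
  rewrite [p]surjective_pairing [q]surjective_pairing; congr pair; apply: (mulIf D_neq0).
    apply/eqP; rewrite -subr_eq0; apply/eqP.
    transitivity (u.1 * (det2 (p - p1) v - det2 (q - p1) v) + v.1 * (det2 u (p - p1) - det2 u (q - p1))).
      by rewrite /D /det2 /=; ring.
    by rewrite e1 e2 !subrr !mulr0 addr0.
  apply/eqP; rewrite -subr_eq0; apply/eqP.
  transitivity (u.2 * (det2 (p - p1) v - det2 (q - p1) v) + v.2 * (det2 u (p - p1) - det2 u (q - p1))).
    by rewrite /D /det2 /=; ring.
  by rewrite e1 e2 !subrr !mulr0 addr0.
- by move=> _ /mapP[p ps ->]; apply: onW.
- by move=> _ /mapP[p ps ->]; have [h1 h2] := hh _ ps; split; [apply: up h1|apply: up h2].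
Qed.

(** * Slicing a quadric by planes *)

Lemma size_quadratic_roots (F : fieldType) (a b c : F) (s : seq F) :
  uniq s -> (forall x, x \in s -> a * x ^+ 2 + b * x + c = 0) ->
  (a, b, c) != (0, 0, 0) -> (size s <= 2)%N.
Proof.
move=> us hs; apply: contraNleq.
case: s us hs => [//|x [//|y [//|z s]]] us hs _.
have [nxy nxz nyz] : [/\ x != y, x != z & y != z].
  by move: us; rewrite /= !inE !negb_or -!andbA; do ![case/andP=> ?] => *; split.
have Ex : a * x ^+ 2 + b * x + c = 0 by apply: hs; rewrite !inE eqxx.
have Ey : a * y ^+ 2 + b * y + c = 0 by apply: hs; rewrite !inE eqxx orbT.
have Ez : a * z ^+ 2 + b * z + c = 0 by apply: hs; rewrite !inE eqxx !orbT.
have slope t t' : t != t' -> a * t ^+ 2 + b * t + c = 0 -> a * t' ^+ 2 + b * t' + c = 0 ->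
    a * (t + t') + b = 0.
  rewrite -subr_eq0 => n E E'; apply: (mulfI n); rewrite mulr0.
  transitivity ((a * t ^+ 2 + b * t + c) - (a * t' ^+ 2 + b * t' + c)); first by ring.
  by rewrite E E' subrr.
have Exy := slope _ _ nxy Ex Ey; have Exz := slope _ _ nxz Ex Ez.
have a0 : a = 0.
  rewrite -subr_eq0 in nyz; apply: (mulfI nyz); rewrite mulr0.
  transitivity ((a * (x + y) + b) - (a * (x + z) + b)); first by ring.
  by rewrite Exy Exz subrr.
have b0 : b = 0 by move: Exy; rewrite a0 mul0r add0r.
have c0 : c = 0 by move: Ex; rewrite a0 b0 !mul0r !add0r.
by rewrite a0 b0 c0.
Qed.

Lemma box_size (n : nat) (M : nat) (J : seq 'I_n) (L : seq 'rV[int]_n) (t0 : 'rV[int]_n) :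
  uniq L -> (forall t, t \in L -> forall i, i \notin J -> t 0 i = t0 0 i) ->
  (forall t, t \in L -> forall i, `|t 0 i| <= M%:Z) ->
  (size L <= (2 * M).+1 ^ size J)%N.
Proof.
elim: J L t0 => [|j J IHJ] L t0 uL agr bnd.
  have := @uniq_leq_size _ L [:: t0] uL; apply=> t /agr h.
  by rewrite inE; apply/eqP/rowP => i; apply: h.
rewrite /= expnS mulnC -(size_irange M).
apply: (@size_le_fibers _ _ (fun t : 'rV[int]_n => t 0 j)) => [t tL|s _].
  by rewrite mem_irange bnd.
set Ls := filter _ _.
have LsP t : t \in Ls -> t \in L /\ t 0 j = s by rewrite mem_filter => /andP[/eqP].
have : uniq Ls by apply: filter_uniq.
case: Ls LsP => [//|t1 Ls] LsP uLs; rewrite size_irange.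
have [t1L t1j] := LsP t1 (mem_head _ _).
apply: (IHJ _ t1 uLs) => [t /LsP[tL tj] i iJ|t /LsP[tL _]]; last exact: bnd.
have [->|ij] := eqVneq i j; first by rewrite tj t1j.
have ijJ : i \notin j :: J by rewrite inE negb_or ij.
by rewrite (agr _ tL) // (agr _ t1L).
Qed.

(** Only the restriction to each line parallel to an axis has to be quadratic. This is all that an
    induction on coordinates uses, and no polynomial representing [F] is needed. *)
Definition quadratic_on_lines (n : nat) (F : 'rV[int]_n -> rat) :=
  forall (j : 'I_n) (t : 'rV[int]_n), exists a b c : rat, forall t' : 'rV[int]_n, (forall i, i != j -> t' 0 i = t 0 i) ->
    F t' = a * (t' 0 j)%:~R ^+ 2 + b * (t' 0 j)%:~R + c.

(** A Schwartz-Zippel count. Along the axis [j] through [t0] the function is a nonzero quadratic, so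
    at most two values of the coordinate are bad, each with a full box of points behind it. For any
    other value the modified [t0] is a witness for the induction. *)
Lemma zeros_size (n : nat) (F : 'rV[int]_n -> rat) (M : nat) (J : seq 'I_n)
    (L : seq 'rV[int]_n) (t0 : 'rV[int]_n) :
  quadratic_on_lines F -> F t0 != 0 ->
  uniq L -> (forall t, t \in L -> forall i, i \notin J -> t 0 i = t0 0 i) ->
  (forall t, t \in L -> forall i, `|t 0 i| <= M%:Z) ->
  (forall t, t \in L -> F t = 0) ->
  (size L <= 2 * size J * (2 * M).+1 ^ (size J).-1)%N.
Proof.
move=> quadF; elim: J L t0 => [|j J IHJ] L t0 Ft0 uL agr bnd zer.
  case: L uL agr bnd zer => // t L uL agr _ zer.
  have tE : t = t0 by apply/rowP => i; apply: agr => //; apply: mem_head.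
  by rewrite -tE zer ?mem_head ?eqxx in Ft0.
pose upd (s : int) : 'rV[int]_n := \row_i (if i == j then s else t0 0 i).
have updj s : upd s 0 j = s by rewrite mxE eqxx.
have updi s i : i != j -> upd s 0 i = t0 0 i by move=> ij; rewrite mxE (negPf ij).
pose P (t : 'rV[int]_n) := F (upd (t 0 j)) == 0.
have -> : size L = (size [seq t <- L | P t] + size [seq t <- L | ~~ P t])%N.
  by rewrite !size_filter -(count_predC P).
have -> : (2 * size (j :: J) * (2 * M).+1 ^ (size (j :: J)).-1 =
   (2 * M).+1 ^ size J * 2 + 2 * size J * (2 * M).+1 ^ size J)%N.
  by rewrite /= mulnS mulnDl mulnC.
apply: leq_add.
  set R := [seq s <- irange M | F (upd s) == 0].
  have R2 : (size R <= 2)%N.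
    have [a [b [c abc]]] := quadF j t0.
    rewrite -(size_map (fun s : int => s%:~R : rat)).
    apply: (@size_quadratic_roots _ a b c).
    - rewrite map_inj_uniq; last exact: intr_inj.
      rewrite filter_uniq // map_inj_uniq ?iota_uniq //.
      by move=> x y; lia.
    - move=> _ /mapP[s sR ->].
      move: sR; rewrite mem_filter => /andP[/eqP Fs _].
      by rewrite -Fs (abc (upd s)) ?updj // => i /updi.
    - apply: contraNneq Ft0 => -[a0 b0 c0].
      by rewrite (abc t0) // a0 b0 c0 !mul0r !addr0.
  apply: leq_trans (_ : _ <= (2 * M).+1 ^ size J * size R)%N _; last first.
    by rewrite leq_mul2l R2 orbT.
  apply: (@size_le_fibers _ _ (fun t : 'rV[int]_n => t 0 j)) => [t|s _].
    by rewrite !mem_filter mem_irange => /andP[Pt tL]; apply/andP; split=> //; exact: bnd.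
  have fP t : t \in [seq x : 'rV[int]_n <- [seq t <- L | P t] | x 0 j == s] -> t \in L /\ t 0 j = s.
    by rewrite !mem_filter => /andP[/eqP-> /andP[_]].
  apply: (@box_size _ _ _ _ (upd s)); first by rewrite !filter_uniq.
    move=> t /fP[tL tj] i iJ; have [->|ij] := eqVneq i j; first by rewrite tj updj.
    by rewrite (agr _ tL) ?updi // inE negb_or ij.
  by move=> t /fP[tL _]; apply: bnd.
(* With no free coordinate left the truncated exponent is of no use, but a point of [L] then
   coincides with its modified [t0], so the second list is empty. *)
have [/size0nil J0|J0] := posnP (size J).
  rewrite J0 muln0 mul0n leqn0 size_eq0.
  apply/negPn; rewrite -has_filter; apply/hasPn => t tL; rewrite negbK /P.
  suff -> : upd (t 0 j) = t by rewrite zer.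
  apply/rowP => i; have [->|ij] := eqVneq i j; first by rewrite updj.
  by rewrite updi // (agr _ tL) // J0 inE.
have -> : (2 * size J * (2 * M).+1 ^ size J =
           2 * size J * (2 * M).+1 ^ (size J).-1 * size (irange M))%N.
  by rewrite size_irange -[RHS]mulnA -expnSr prednK.
apply: (@size_le_fibers _ _ (fun t : 'rV[int]_n => t 0 j)) => [t|s _].
  by rewrite mem_filter mem_irange => /andP[_ tL]; rewrite bnd.
have fP t : t \in [seq x : 'rV[int]_n <- [seq t <- L | ~~ P t] | x 0 j == s] ->
    [/\ t \in L, t 0 j = s & F (upd s) != 0].
  by rewrite !mem_filter => /andP[/eqP <- /andP[]].
have [Fs|Fs] := eqVneq (F (upd s)) 0.
  case: (filter _ _) fP => // t r /(_ t (mem_head _ _))[_ _].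
  by rewrite Fs eqxx.
apply: (IHJ _ (upd s) Fs); first by rewrite !filter_uniq.
- move=> t /fP[tL tj _] i iJ; have [->|ij] := eqVneq i j; first by rewrite tj updj.
  by rewrite (agr _ tL) ?updi // inE negb_or ij.
- by move=> t /fP[tL _ _]; apply: bnd.
- by move=> t /fP[tL _ _]; apply: zer.
Qed.

Local Notation qrow := (map_mx (intr : int -> rat)).

Lemma conic_trivial_size (a b c d e g : rat) (M : nat) (s : seq (int * int)) :
  a != 0 -> uniq s ->
  (forall p, p \in s -> conic a b c d e g p.1%:~R p.2%:~R = 0) ->
  (forall p, p \in s -> `|p.2| <= M%:Z) ->
  (size s <= 2 * (2 * M).+1)%N.
Proof.
move=> a0 us hs hM; rewrite -(size_irange M).
apply: (@size_le_fibers _ _ snd) => [p ps|y _]; first by rewrite mem_irange hM.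
rewrite -(size_map (fun p : int * int => p.1%:~R : rat)).
apply: (@size_quadratic_roots _ a (b * y%:~R + d) (c * y%:~R ^+ 2 + e * y%:~R + g)).
- rewrite map_inj_in_uniq ?filter_uniq // => p q; rewrite !mem_filter.
  move=> /andP[/eqP py _] /andP[/eqP qy _] /intr_inj pq.
  by rewrite [p]surjective_pairing [q]surjective_pairing py qy pq.
- move=> _ /mapP[p ps ->]; move: ps; rewrite mem_filter => /andP[/eqP <- /hs <-].
  by rewrite /conic; ring.
- by apply: contra a0 => /eqP[->].
Qed.

(** The norm equation becomes [z^2 = D x^2], which forces [z = x = 0] when [D] is not a square: only
    the centre of the conic is left. *)
Lemma anisotropic_conic_size (a b c d e g : rat) (s : seq (int * int)) :
  a != 0 -> qdisc a b c != 0 -> (forall x, x ^+ 2 != qdisc a b c) ->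
  cdisc a b c d e g = 0 -> uniq s ->
  (forall p, p \in s -> conic a b c d e g p.1%:~R p.2%:~R = 0) -> (size s <= 1)%N.
Proof.
move=> a0 D0 nsq T0 us hs.
have center p : p \in s ->
   qdisc a b c * p.2%:~R + (b * d - 2%:R * a * e) = 0 /\
   2%:R * a * p.1%:~R + b * p.2%:~R + d = 0.
  move=> ps; have := conic_norm a b c d e g p.1%:~R p.2%:~R.
  rewrite T0 (hs _ ps) !mulr0 subrr.
  set z := _ + (b * d - _); set x := _ + d => E.
  have [x0|xn] := eqVneq x 0.
    by move: E; rewrite x0 expr0n mulr0 subr0 => /eqP; rewrite expf_eq0 => /eqP.
  have := nsq (z / x); rewrite expr_div_n.
  have -> : z ^+ 2 = qdisc a b c * x ^+ 2 by apply/eqP; rewrite -subr_eq0 E.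
  by rewrite mulfK ?eqxx // expf_neq0.
case: s us hs center => [//|p [//|q s]] us hs center.
have pq : p == q.
  have [z1 x1] := center p (mem_head _ _).
  have qs : q \in [:: p, q & s] by rewrite !inE eqxx orbT.
  have [z2 x2] := center q qs.
  have e2 : p.2 = q.2.
    apply: (@intr_inj rat); apply: (mulfI D0); apply: (addIr (b * d - 2%:R * a * e)).
    by rewrite z1 z2.
  have n2 : 2%:R * a != 0 by rewrite mulf_neq0.
  apply/eqP; rewrite [p]surjective_pairing [q]surjective_pairing e2; congr pair.
  apply: (@intr_inj rat); apply: (mulfI n2); apply: (addIr (b * q.2%:~R)); apply: (addIr d).
  by rewrite x2 -e2 x1.
by move: us; rewrite /= inE pq.
Qed.

Section QuadraticFunction.
Variables (n : nat) (A : 'M[rat]_n) (l : 'cV[rat]_n) (c0 : rat).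
Implicit Types x y u v w t : 'rV[rat]_n.

Definition bil x y : rat := (x *m A *m y^T) 0 0.
Definition lin x : rat := (x *m l) 0 0.
Definition polar x y := bil x y + bil y x.
Definition quadf x := c0 + lin x + bil x x.

Lemma bilDl x y w : bil (x + y) w = bil x w + bil y w.
Proof. by rewrite /bil !mulmxDl mxE. Qed.
Lemma bilDr x y w : bil w (x + y) = bil w x + bil w y.
Proof. by rewrite /bil linearD /= mulmxDr mxE. Qed.
Lemma bilZl k x y : bil (k *: x) y = k * bil x y.
Proof. by rewrite /bil -!scalemxAl mxE. Qed.
Lemma bilZr k x y : bil x (k *: y) = k * bil x y.
Proof. by rewrite /bil linearZ /= -scalemxAr mxE. Qed.
Lemma linD x y : lin (x + y) = lin x + lin y.
Proof. by rewrite /lin mulmxDl mxE. Qed.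
Lemma linZ k x : lin (k *: x) = k * lin x.
Proof. by rewrite /lin -scalemxAl mxE. Qed.

Definition bilE := (bilDl, bilDr, bilZl, bilZr, linD, linZ).

(** The derivative of [quadf] at [t] in the direction [u]. *)
Definition quadf' u t := polar u t + lin u.

Definition slice_cdisc u v t :=
  cdisc (bil u u) (polar u v) (bil v v) (quadf' u t) (quadf' v t) (quadf t).

Lemma quadf_slice u v t (x y : rat) :
  quadf (t + x *: u + y *: v) =
  conic (bil u u) (polar u v) (bil v v) (quadf' u t) (quadf' v t) (quadf t) x y.
Proof. by rewrite /quadf /conic /quadf' /polar !bilE; ring. Qed.

(** The discriminant depends on the plane alone, so a base point may be replaced by the normalised
    one of the same plane. *)
Lemma slice_cdisc_invariant u v t (x y : rat) :
  slice_cdisc u v (t + x *: u + y *: v) = slice_cdisc u v t.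
Proof.
rewrite /slice_cdisc quadf_slice.
have -> : quadf' u (t + x *: u + y *: v) = quadf' u t + 2%:R * bil u u * x + polar u v * y.
  by rewrite /quadf' /polar !bilE; ring.
have -> : quadf' v (t + x *: u + y *: v) = quadf' v t + polar u v * x + 2%:R * bil v v * y.
  by rewrite /quadf' /polar !bilE; ring.
by rewrite /cdisc /conic /qdisc; ring.
Qed.

Lemma slice_cdisc_line u v w t : exists a b c : rat, forall s : rat,
  slice_cdisc u v (t + s *: w) = a * s ^+ 2 + b * s + c.
Proof.
set au := bil u u; set b := polar u v; set c := bil v v.
set du := quadf' u t; set dv := quadf' v t; set g := quadf t.
pose pu := polar u w; pose pv := polar v w; pose pw := quadf' w t; pose qw := bil w w.
exists (au * pv ^+ 2 - b * pu * pv + c * pu ^+ 2 + qdisc au b c * qw),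
  (2%:R * au * dv * pv - b * (du * pv + dv * pu) + 2%:R * c * du * pu + qdisc au b c * pw),
  (cdisc au b c du dv g) => s.
rewrite /slice_cdisc.
have -> : quadf (t + s *: w) = g + s * pw + s ^+ 2 * qw.
  by rewrite /g /pw /qw /quadf /quadf' /polar !bilE; ring.
have -> : quadf' u (t + s *: w) = du + s * pu.
  by rewrite /du /pu /quadf' /polar !bilE; ring.
have -> : quadf' v (t + s *: w) = dv + s * pv.
  by rewrite /dv /pv /quadf' /polar !bilE; ring.
by rewrite -/au -/b -/c /cdisc; ring.
Qed.

Lemma slice_cdisc_quadratic_on_lines u v :
  quadratic_on_lines (fun t : 'rV[int]_n => slice_cdisc u v (qrow t)).
Proof.
move=> j t; have [a [b [c abc]]] := slice_cdisc_line u v (delta_mx 0 j) (qrow t).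
pose tj : rat := (t 0 j)%:~R.
exists a, (b - 2%:R * a * tj), (c - b * tj + a * tj ^+ 2) => t' agr.
have -> : qrow t' = qrow t + ((t' 0 j)%:~R - tj) *: delta_mx 0 j.
  apply/rowP => i; rewrite !mxE /=; have [->|ij] := eqVneq i j.
    by rewrite mulr1 /tj; ring.
  by rewrite agr // mulr0 addr0.
by rewrite abc; ring.
Qed.

End QuadraticFunction.

(** The entries at [i0] and [j0] are pivots: every point is an integral combination of [u] and [v]
    plus a vector [pr a] vanishing at both, so a slice is given by [n - 2] free coordinates. Entries
    at most 1 give coefficients at most [N] and [2 * N], hence [pr a] at most [4 * N], and there are
    at most [(8 * N + 1) ^ (n - 2) <= (9 * N) ^ (n - 2)] slices. *)
Lemma quadric_size (n k : nat) : (2 < n)%N -> (0 < k)%N -> exists C : nat,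
  forall (A : 'M[rat]_n) (l : 'cV[rat]_n) (c0 : rat) (u v : 'rV[int]_n) (i0 j0 : 'I_n)
    (N : nat) (L : seq 'rV[int]_n),
  (0 < N)%N -> u 0 i0 = 1 -> v 0 i0 = 0 -> v 0 j0 ^+ 2 = 1 ->
  (forall i, `|u 0 i| <= 1) -> (forall i, `|v 0 i| <= 1) ->
  let D := qdisc (bil A (qrow u) (qrow u)) (polar A (qrow u) (qrow v))
                 (bil A (qrow v) (qrow v)) in
  bil A (qrow u) (qrow u) != 0 -> D != 0 ->
  (forall x, x ^+ 2 != D) \/
    (exists t : 'rV[int]_n, slice_cdisc A l c0 (qrow u) (qrow v) (qrow t) != 0) ->
  uniq L -> (forall a, a \in L -> quadf A l c0 (qrow a) = 0) ->
  (forall a, a \in L -> forall i, `|a 0 i| <= N%:Z) ->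
  (size L ^ k <= C * N ^ (k * (n - 2) + 1))%N.
Proof.
move=> n2 k0; have [C1 hC1] := conic_size k0.
(* A singular slice has at most [2 * (4 * N + 1)] points, and
   [2 * (4 * N + 1) * (2 * n) <= 20 * n * N]; the summand 1 keeps [K] positive for slices with a
   single point. *)
pose K := (20 * n + 1)%N.
exists (K.+1 ^ k * (2 * C1).+1 * 9 ^ (k * (n - 2)))%N.
move=> A l c0 u v i0 j0 N L N0 ui0 vi0 vj0 ub vb D a0 D0 hsq uL hL bL.
have j0i0 : j0 != i0 by apply: contraTneq isT => e; move: vj0; rewrite e vi0 expr0n.
pose x (a : 'rV[int]_n) := a 0 i0.
pose y (a : 'rV[int]_n) := v 0 j0 * (a 0 j0 - a 0 i0 * u 0 j0).
pose pr (a : 'rV[int]_n) := a - x a *: u - y a *: v.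
pose J := [seq i <- enum 'I_n | i \notin [:: i0; j0]].
have sJ : size J = (n - 2)%N.
  have := count_predC (mem [:: i0; j0]) (enum 'I_n); rewrite size_enum_ord.
  have -> : count (mem [:: i0; j0]) (enum 'I_n) = 2%N.
    rewrite -size_filter -(perm_size (s1 := [:: i0; j0])) //.
    apply: uniq_perm; first by rewrite /= inE eq_sym j0i0.
      by rewrite filter_uniq // enum_uniq.
    by move=> i; rewrite mem_filter mem_enum andbT.
  by rewrite -size_filter -/J; move: (size J) => m hm; clear - hm; lia.
have prJ a i : i \notin J -> pr a 0 i = 0.
  rewrite mem_filter mem_enum andbT negbK !inE => /orP[] /eqP ->; rewrite !mxE /x /y.
    by rewrite ui0 vi0; ring.
  rewrite (_ : _ * _ * _ = v 0 j0 ^+ 2 * (a 0 j0 - a 0 i0 * u 0 j0)); last by ring.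
  by rewrite vj0; ring.
have aE a : qrow a = qrow (pr a) + (x a)%:~R *: qrow u + (y a)%:~R *: qrow v.
  apply/rowP => i; rewrite !mxE !(intrB, intrM, intrD) /=.
  by rewrite -!addrA; ring.
have xb a : a \in L -> `|x a| <= N%:Z by move=> aL; apply: bL.
have nvj : `|v 0 j0| = 1.
  have /eqP : (v 0 j0 - 1) * (v 0 j0 + 1) = 0.
    by transitivity (v 0 j0 ^+ 2 - 1); [ring | rewrite vj0 subrr].
  by rewrite mulf_eq0 => /orP[] /eqP; lia.
have yb a : a \in L -> `|y a| <= (2 * N)%N%:Z.
  move=> aL; rewrite normrM nvj mul1r.
  have h1 := bL _ aL j0; have h2 := bL _ aL i0.
  have h3 : `|a 0 i0 * u 0 j0| <= N%:Z by rewrite normrM -[N%:Z]mulr1 ler_pM.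
  apply: le_trans (ler_normB _ _) _; apply: le_trans (lerD h1 h3) _.
  by clear; lia.
have prb a : a \in L -> forall i, `|pr a 0 i| <= (4 * N)%N%:Z.
  move=> aL i; rewrite !mxE.
  have h1 := bL _ aL i.
  have h2 : `|x a * u 0 i| <= N%:Z by rewrite normrM -[N%:Z]mulr1 ler_pM ?xb.
  have h3 : `|y a * v 0 i| <= (2 * N)%N%:Z by rewrite normrM -[(2 * N)%N%:Z]mulr1 ler_pM ?yb.
  apply: le_trans (ler_normB _ _) _; apply: le_trans (lerD (ler_normB _ _) h3) _.
  by apply: le_trans (lerD (lerD h1 h2) (lexx _)) _; clear; lia.
pose Th (t : 'rV[int]_n) := slice_cdisc A l c0 (qrow u) (qrow v) (qrow t).
pose fib (r : seq 'rV[int]_n) t := [seq a <- r | pr a == t].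
pose co (t : 'rV[int]_n) (p : rat * rat) := conic (bil A (qrow u) (qrow u)) (polar A (qrow u) (qrow v))
  (bil A (qrow v) (qrow v)) (quadf' A l (qrow u) (qrow t)) (quadf' A l (qrow v) (qrow t))
  (quadf A l c0 (qrow t)) p.1 p.2.
have fibP (r : seq 'rV[int]_n) t : uniq r -> {subset r <= L} ->
    let s := [seq (x a, y a) | a <- fib r t] in
    [/\ uniq s, forall p, p \in s -> co t (p.1%:~R, p.2%:~R) = 0 &
        forall p, p \in s -> `|p.1| <= (2 * N)%N%:Z /\ `|p.2| <= (2 * N)%N%:Z].
  move=> ur rL s; split.
  - rewrite map_inj_in_uniq ?filter_uniq // => a b.
    rewrite !mem_filter => /andP[/eqP pa _] /andP[/eqP pb _] [exx eyy].
    have : pr a = pr b by rewrite pa pb.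
    by rewrite /pr exx eyy => /addIr/addIr.
  - move=> _ /mapP[a + ->]; rewrite mem_filter => /andP[/eqP <- /rL/hL].
    by rewrite (aE a) quadf_slice.
  - move=> _ /mapP[a + ->]; rewrite mem_filter => /andP[_ /rL aL] /=.
    by split; [have := xb _ aL; clear; lia | apply: yb].
have TL (r : seq 'rV[int]_n) : {subset r <= L} ->
    (size (undup (map pr r)) <= (9 * N) ^ (n - 2))%N.
  move=> rL; apply: leq_trans (_ : (2 * (4 * N)).+1 ^ size J <= _)%N.
    apply: (@box_size _ _ _ _ 0); first exact: undup_uniq.
      by move=> t; rewrite mem_undup => /mapP[a _ ->] i iJ; rewrite prJ // mxE.
    by move=> t; rewrite mem_undup => /mapP[a /rL aL ->]; apply: prb.
  rewrite sJ leq_exp2r; last by clear - n2; lia.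
  by clear - N0; lia.
pose L1 := [seq a <- L | Th (pr a) != 0]; pose L2 := [seq a <- L | Th (pr a) == 0].
have L1L : {subset L1 <= L} by move=> a; rewrite mem_filter => /andP[].
have L2L : {subset L2 <= L} by move=> a; rewrite mem_filter => /andP[].
have uL1 : uniq L1 by rewrite filter_uniq.
have uL2 : uniq L2 by rewrite filter_uniq.
(* The size of the largest nonsingular slice, kept positive so that [K + M <= (K + 1) * M]. *)
pose M := maxn 1 (\max_(t <- undup (map pr L1)) size (fib L1 t)).
have Mk : (M ^ k <= (2 * C1).+1 * N)%N.
  rewrite /M; set X := (\max_(t <- _) _)%N; case: (leqP 1 X) => _; last first.
    by rewrite exp1n muln_gt0.
  rewrite /X big_seq; elim/big_ind: _ => [|p q hp hq|t]; first by rewrite exp0n.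
    by case: (leqP p q).
  rewrite mem_undup => /mapP[a + tE]; rewrite mem_filter => /andP[Ta aL].
  have [us hs hb] := fibP L1 t uL1 L1L.
  rewrite -(size_map (fun a => (x a, y a))).
  have N20 : (0 < 2 * N)%N by clear - N0; lia.
  have T0 : Th t != 0 by rewrite tE.
  apply: leq_trans (hC1 _ _ _ _ _ _ (2 * N)%N _ N20 D0 T0 us hs hb) _.
  by clear; nia.
have sL1 : (size L1 <= M * (9 * N) ^ (n - 2))%N.
  apply: leq_trans (_ : _ <= M * size (undup (map pr L1)))%N _; last first.
    by rewrite leq_mul2l TL // orbT.
  apply: (@size_le_fibers _ _ pr) => [a aL|t tL]; first by rewrite mem_undup map_f.
  rewrite /M leq_max; apply/orP; right.
  exact: (@leq_bigmax_seq _ _ xpredT (fun t => size (fib L1 t))).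
have sL2 : (size L2 <= K * (9 * N) ^ (n - 2))%N.
  case: hsq => [nsq|[t Tt]].
    apply: leq_trans (_ : _ <= 1 * size (undup (map pr L2)))%N _; last first.
      by rewrite mul1n; apply: leq_trans (TL _ L2L) _; apply: leq_pmull; rewrite /K addn1.
    apply: (@size_le_fibers _ _ pr) => [a aL|t]; first by rewrite mem_undup map_f.
    rewrite mem_undup => /mapP[a + tE]; rewrite mem_filter => /andP[/eqP Ta aL].
    have [us hs hb] := fibP L2 t uL2 L2L.
    rewrite -(size_map (fun a => (x a, y a))).
    by apply: (anisotropic_conic_size a0 D0 nsq _ us hs); rewrite tE.
  have sT : (size (undup (map pr L2)) <= 2 * size J * (2 * (4 * N)).+1 ^ (size J).-1)%N.
    apply: (@zeros_size _ Th _ _ _ (pr t)).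
    - exact: slice_cdisc_quadratic_on_lines.
    (* The witness is moved inside its plane to [pr t], which agrees with all base points outside
       [J]. *)
    - by rewrite /Th; move: Tt; rewrite (aE t) slice_cdisc_invariant.
    - exact: undup_uniq.
    - by move=> t'; rewrite mem_undup => /mapP[a _ ->] i iJ; rewrite !prJ.
    - by move=> t'; rewrite mem_undup => /mapP[a /L2L aL ->]; apply: prb.
    - move=> t'; rewrite mem_undup => /mapP[a + ->].
      by rewrite mem_filter => /andP[/eqP].
  apply: leq_trans (_ : _ <= (2 * (2 * (2 * N)).+1) * size (undup (map pr L2)))%N _.
    apply: (@size_le_fibers _ _ pr) => [a aL|t' _]; first by rewrite mem_undup map_f.
    have [us hs hb] := fibP L2 t' uL2 L2L.
    rewrite -(size_map (fun a => (x a, y a))).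
    by apply: (conic_trivial_size a0 us hs) => p /hb[].
  apply: leq_trans (leq_mul (leqnn _) sT) _; rewrite sJ.
  have n21 : (n - 2 = (n - 2).-1.+1)%N by clear - n2; lia.
  rewrite [X in (_ <= _ * (_ ^ X))%N]n21 expnS.
  have : ((2 * (4 * N)).+1 ^ (n - 2).-1 <= (9 * N) ^ (n - 2).-1)%N.
    have [->//|h] := posnP (n - 2).-1.
    by rewrite leq_exp2r //; clear - N0; lia.
  move: ((2 * (4 * N)).+1 ^ _)%N ((9 * N) ^ _)%N => p q pq.
  have h1 : (2 * (n - 2) * p <= 2 * n * q)%N by rewrite leq_mul // leq_mul2l leq_subr.
  apply: leq_trans (leq_mul (leqnn _) h1) _.
  have h2 : (2 * (2 * (2 * N)).+1 * (2 * n) <= K * (9 * N))%N by rewrite /K; clear - N0; nia.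
  by rewrite !mulnA leq_mul2r; apply/orP; right; rewrite -!mulnA in h2 *.
have sL : (size L <= K.+1 * M * (9 * N) ^ (n - 2))%N.
  have -> : size L = (size L2 + size L1)%N.
    by rewrite !size_filter -(count_predC (fun a => Th (pr a) == 0)).
  apply: leq_trans (leq_add sL2 sL1) _; rewrite -mulnDl leq_mul2r; apply/orP; right.
  have : (0 < M)%N by rewrite /M leq_max.
  by rewrite mulSn addnC leq_add2l => M0; apply: leq_pmulr.
apply: leq_trans (_ : (K.+1 * M * (9 * N) ^ (n - 2)) ^ k <= _)%N; first by rewrite leq_exp2r.
rewrite !expnMn addn1 expnS -!expnM (mulnC (n - 2)%N).
move: Mk; move: (M ^ k)%N (K.+1 ^ k)%N (2 * C1).+1 (9 ^ _)%N (N ^ _)%N => p q r s t pr'.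
have -> : (q * r * s * (N * t) = q * (r * N) * (s * t))%N by ring.
by rewrite !leq_mul.
Qed.

(** * Polynomials of degree two *)

Section QuadraticPolynomial.
Variable n : nat.
Implicit Types (A B : 'M[rat]_n) (l p : 'cV[rat]_n) (c : rat) (f : {mpoly rat[n]}).

Definition linpoly l : {mpoly rat[n]} := \sum_i l i 0 *: 'X_i.
(** Symmetry of [A] is not imposed; the polynomial determines only [A + A^T], which is why later
    conditions are stated on that sum. *)
Definition quadpoly A : {mpoly rat[n]} := \sum_i \sum_j A i j *: ('X_i * 'X_j).
Definition qpoly A l c : {mpoly rat[n]} := c%:MP + linpoly l + quadpoly A.

Lemma linpolyD l l' : linpoly (l + l') = linpoly l + linpoly l'.
Proof. by rewrite -big_split; apply: eq_bigr => i _; rewrite mxE scalerDl. Qed.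

Lemma linpolyZ k l : linpoly (k *: l) = k *: linpoly l.
Proof. by rewrite scaler_sumr; apply: eq_bigr => i _; rewrite mxE scalerA. Qed.

Lemma quadpolyD A B : quadpoly (A + B) = quadpoly A + quadpoly B.
Proof.
rewrite -big_split; apply: eq_bigr => i _; rewrite -big_split.
by apply: eq_bigr => j _; rewrite mxE scalerDl.
Qed.

Lemma quadpolyZ k A : quadpoly (k *: A) = k *: quadpoly A.
Proof.
rewrite scaler_sumr; apply: eq_bigr => i _; rewrite scaler_sumr.
by apply: eq_bigr => j _; rewrite mxE scalerA.
Qed.

Lemma quadpoly_tr A : quadpoly A^T = quadpoly A.
Proof.
rewrite /quadpoly exchange_big; apply: eq_bigr => i _; apply: eq_bigr => j _.
by rewrite mxE mulrC.
Qed.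

Lemma linpoly0 : linpoly 0 = 0.
Proof. by rewrite -(scale0r 0) linpolyZ scale0r. Qed.
Lemma quadpoly0 : quadpoly 0 = 0.
Proof. by rewrite -(scale0r 0) quadpolyZ scale0r. Qed.

Lemma quadpoly_sym A : quadpoly A = 2%:R^-1 *: quadpoly (A + A^T).
Proof.
rewrite quadpolyD quadpoly_tr -mulr2n -scaler_nat scalerA mulVf ?scale1r //.
Qed.

Lemma quadpoly_outer l : quadpoly (l *m l^T) = linpoly l * linpoly l.
Proof.
rewrite /linpoly mulr_suml; apply: eq_bigr => i _; rewrite mulr_sumr.
apply: eq_bigr => j _; rewrite mxE big_ord1 mxE.
by rewrite -scalerAl -scalerAr scalerA.
Qed.

Lemma linpoly_delta i : linpoly (delta_mx i 0) = 'X_i.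
Proof.
rewrite /linpoly (bigD1 i) //= big1 => [|j ji]; rewrite mxE ?eqxx ?scale1r ?addr0 //.
by rewrite (negPf ji) scale0r.
Qed.

Lemma quadpoly_delta i j : quadpoly (delta_mx i j) = 'X_i * 'X_j.
Proof.
rewrite -(mul_delta_mx (0 : 'I_1)) /quadpoly -!linpoly_delta /linpoly mulr_suml.
apply: eq_bigr => i' _; rewrite mulr_sumr; apply: eq_bigr => j' _.
rewrite mxE big_ord1 -scalerAl -scalerAr scalerA; congr (_ * _ *: _).
by rewrite !mxE andbC.
Qed.

Lemma qpolyD A l c A' l' c' : qpoly A l c + qpoly A' l' c' = qpoly (A + A') (l + l') (c + c').
Proof. by rewrite /qpoly linpolyD quadpolyD mpolyCD; ring. Qed.

Lemma qpolyZ k A l c : k *: qpoly A l c = qpoly (k *: A) (k *: l) (k * c).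
Proof. by rewrite /qpoly linpolyZ quadpolyZ mpolyCM mul_mpolyC !scalerDr. Qed.

Lemma qpoly_monomial (m : 'X_{1..n}) : (mdeg m <= 2)%N ->
  exists A l c, 'X_[m] = qpoly A l c.
Proof.
case E : (mdeg m) => [|[|[|//]]] _; have /eqP md := E.
- exists 0, 0, 1; rewrite /qpoly linpoly0 quadpoly0 !addr0.
  by move: md; rewrite mdeg_eq0 => /eqP ->; rewrite mpolyX0 mpolyC1.
- have /mdeg1P[i /eqP ->] := md.
  by exists 0, (delta_mx i 0), 0; rewrite /qpoly linpoly_delta quadpoly0 mpolyC0 add0r addr0.
have [i mi] : exists i, m i != 0%N.
  apply/existsP; rewrite -negb_forall; apply: contraTN isT => /forallP h.
  by move: md; rewrite mdegE big1 // => i _; apply/eqP; rewrite -[_ == _]negbK h.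
have mE : (m = (m - U_(i)) + U_(i))%MM by rewrite submK // lep1mP.
have /mdeg1P[j /eqP mj] : mdeg (m - U_(i))%MM == 1%N.
  by move: md; rewrite {1}mE mdegD mdeg1 addn1 eqSS.
exists (delta_mx j i), 0, 0.
by rewrite /qpoly linpoly0 quadpoly_delta mpolyC0 !add0r mE mj mpolyXD.
Qed.

Lemma qpoly_exists f : (msize f <= 3)%N -> exists A l c, f = qpoly A l c.
Proof.
move=> sf; rewrite [f]mpolyE big_seq.
elim/big_ind: _ => [|_ _ [A [l [c ->]]] [A' [l' [c' ->]]]|m mf].
- by exists 0, 0, 0; rewrite /qpoly linpoly0 quadpoly0 mpolyC0 !addr0.
- by exists (A + A'), (l + l'), (c + c'); rewrite qpolyD.
have [A [l [c ->]]] : exists A l c, 'X_[m] = qpoly A l c.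
  by apply: qpoly_monomial; rewrite -ltnS; apply: leq_trans (msize_mdeg_lt mf) sf.
by exists (f@_m *: A), (f@_m *: l), (f@_m * c); rewrite qpolyZ.
Qed.

Lemma meval_qpoly A l c (x : 'rV[rat]_n) :
  (qpoly A l c).@[fun i => x 0 i] = quadf A l c x.
Proof.
rewrite /qpoly /quadf !mevalD mevalC; congr (_ + _ + _).
  rewrite /linpoly raddf_sum /lin mxE; apply: eq_bigr => i _ /=.
  by rewrite mevalZ mevalXU mulrC.
rewrite /quadpoly raddf_sum /bil -mulmxA mxE; apply: eq_bigr => i _ /=.
rewrite raddf_sum mxE mulr_sumr; apply: eq_bigr => j _ /=.
by rewrite mevalZ mevalM !mevalXU !mxE; ring.
Qed.

Lemma linpoly_homog l : linpoly l \is 1.-homog.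
Proof.
by apply: rpred_sum => i _; apply: dhomogZ; rewrite dhomogX; apply/eqP; apply: mdeg1.
Qed.

Lemma quadpoly_homog A : quadpoly A \is 2.-homog.
Proof.
apply: rpred_sum => i _; apply: rpred_sum => j _; apply: dhomogZ.
by rewrite (_ : 2%N = (1 + 1)%N) // dhomogM // dhomogX /= mdeg1.
Qed.

Lemma quad_part_qpoly A l c : quad_part (qpoly A l c) = quadpoly A.
Proof.
have hc : c%:MP_[n] \is 0.-homog.
  by rewrite -[c%:MP_[n]]mulr1 mul_mpolyC; apply: dhomogZ; apply: dhomog1.
rewrite /quad_part !pihomogD.
rewrite (pihomog_dE (quadpoly_homog A)) (@pihomog_ne0 _ _ _ 0 2 _ isT hc).
by rewrite (@pihomog_ne0 _ _ _ 1 2 _ isT (linpoly_homog l)) !add0r.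
Qed.

Lemma bil_delta A i j : bil A (delta_mx 0 i) (delta_mx 0 j) = A i j.
Proof. by rewrite /bil -rowE trmx_delta -colE !mxE. Qed.

Lemma lin_delta l i : lin l (delta_mx 0 i) = l i 0.
Proof. by rewrite /lin -rowE mxE. Qed.

(** The values at 0, at plus and minus the basis vectors and at sums of two of them already
    determine the coefficients. *)
Lemma qpoly_eq0 A l c : (forall t : 'rV[int]_n, quadf A l c (qrow t) = 0) -> qpoly A l c = 0.
Proof.
move=> h.
have qd i : qrow (delta_mx 0 i : 'rV[int]_n) = delta_mx 0 i.
  exact: map_delta_mx.
have c0 : c = 0.
  have := h 0; rewrite map_mx0 /quadf /lin /bil !mul0mx !mxE.
  by rewrite !addr0.
have li i : l i 0 = 0 /\ A i i = 0.
  have := h (delta_mx 0 i); have := h ((-1) *: delta_mx 0 i).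
  rewrite map_mxZ qd /quadf !bilE bil_delta lin_delta c0 /=; lra.
have A0 : A + A^T = 0.
  apply/matrixP => i j; rewrite !mxE.
  have := h (delta_mx 0 i + delta_mx 0 j).
  rewrite map_mxD !qd /quadf !bilE !bil_delta !lin_delta c0.
  have [-> ->] := li i; have [-> ->] := li j; lra.
rewrite /qpoly quadpoly_sym A0 quadpoly0 scaler0 c0 mpolyC0 add0r addr0.
by rewrite /linpoly big1 // => i _; have [-> _] := li i; rewrite scale0r.
Qed.

End QuadraticPolynomial.

Section Degrees.
Variable n : nat.
Implicit Types p q : {mpoly rat[n]}.

Lemma msizeM_leq p q (a b : nat) : (msize p <= a.+1)%N -> (msize q <= b.+1)%N ->
  (msize (p * q) <= (a + b).+1)%N.
Proof.
move=> ha hb; have [->|p0] := eqVneq p 0; first by rewrite mul0r mmeasure0.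
have [->|q0] := eqVneq q 0; first by rewrite mulr0 mmeasure0.
by rewrite msizeM //; move: ha hb; move: (msize p) (msize q); lia.
Qed.

Lemma msizeD_leq p q (a : nat) : (msize p <= a)%N -> (msize q <= a)%N ->
  (msize (p + q) <= a)%N.
Proof.
by move=> ha hb; apply: leq_trans (mmeasureD_le _ _ _) _; rewrite geq_max ha.
Qed.

Lemma msizeB_leq p q (a : nat) : (msize p <= a)%N -> (msize q <= a)%N ->
  (msize (p - q) <= a)%N.
Proof. by move=> ha hb; apply: msizeD_leq; rewrite ?mmeasureN. Qed.

Lemma msizeC_leq (c : rat) : (msize c%:MP_[n] <= 1)%N.
Proof. by rewrite mmeasureC; case: (_ == _). Qed.

Lemma msize_homog_leq p (d : nat) : p \is d.-homog -> (msize p <= d.+1)%N.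
Proof.
move=> /dhomogP h; rewrite msizeE big_seq; elim/big_ind: _ => // [a b ha hb|m /h /= ->//].
by rewrite geq_max ha.
Qed.

End Degrees.

(** * Small integer vectors spanning a nondegenerate plane *)

Lemma small_vector (n : nat) (B : 'M[rat]_n) : B + B^T != 0 ->
  exists w : 'rV[int]_n, (forall i, 0 <= w 0 i <= 1) /\ bil B (qrow w) (qrow w) != 0.
Proof.
case/matrix0Pn=> i [j]; rewrite !mxE => Bij.
have qd k : qrow (delta_mx 0 k : 'rV[int]_n) = delta_mx 0 k by apply: map_delta_mx.
have db k k' : 0 <= (delta_mx 0 k : 'rV[int]_n) 0 k' <= 1 by rewrite mxE eqxx /=; case: (k' == k).
have [Bi|] := eqVneq (B i i) 0; last first.
  by exists (delta_mx 0 i); split=> //; rewrite qd bil_delta.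
have [Bj|] := eqVneq (B j j) 0; last first.
  by exists (delta_mx 0 j); split=> //; rewrite qd bil_delta.
(* With both diagonal entries zero, the form takes the nonzero value [B i j + B j i] at the sum of
   the two basis vectors. *)
have ij : i != j by apply: contraNneq Bij => ij; rewrite -ij Bi addr0.
exists (delta_mx 0 i + delta_mx 0 j); split=> [k|].
  rewrite !mxE !eqxx /=; have [->|_] := eqVneq k i; last by case: (k == j).
  by rewrite (negPf ij).
by rewrite map_mxD !qd !bilE !bil_delta Bi Bj add0r addr0.
Qed.

Section Frame.
Variables (n : nat) (A : 'M[rat]_n).

Lemma polar_lin (u x : 'rV[rat]_n) : polar A u x = lin ((A + A^T) *m u^T) x.
Proof.
rewrite /polar addrC /lin /bil mulmxDl mulmxDr [in RHS]mxE mulmxA; congr (_ + _).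
by rewrite -[in LHS](trmxK (u *m A *m x^T)) mxE !trmx_mul trmxK mulmxA.
Qed.

Lemma bil_outer (p : 'cV[rat]_n) (x : 'rV[rat]_n) : bil (p *m p^T) x x = lin p x ^+ 2.
Proof.
by rewrite /bil /lin mulmxA -mulmxA -trmx_mul mxE big_ord1 [X in _ * X]mxE expr2.
Qed.

(** For fixed [u], the discriminant of the plane spanned by [u] and [x] is itself a quadratic form
    in [x], with matrix [B]. Either it is nonzero at a small vector, or its vanishing exhibits
    [A + A^T] as a multiple of [p *m p^T]. *)
Lemma slice_frame : A + A^T != 0 ->
  (exists (u v : 'rV[int]_n) (i0 j0 : 'I_n),
    [/\ u 0 i0 = 1, v 0 i0 = 0, v 0 j0 ^+ 2 = 1,
       (forall i, `|u 0 i| <= 1) /\ (forall i, `|v 0 i| <= 1) &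
       bil A (qrow u) (qrow u) != 0 /\
       qdisc (bil A (qrow u) (qrow u)) (polar A (qrow u) (qrow v))
             (bil A (qrow v) (qrow v)) != 0]) \/
  (exists (k : rat) (p : 'cV[rat]_n), A + A^T = k *: (p *m p^T)).
Proof.
move=> /small_vector[u [ub a0]]; set a := bil _ _ _ in a0.
pose p := (A + A^T) *m (qrow u)^T.
pose B := p *m p^T - (4%:R * a) *: A.
have bB x : bil B x x = qdisc a (polar A (qrow u) x) (bil A x x).
  rewrite polar_lin -/p /qdisc -bil_outer /B /bil mulmxBr mulmxBl.
  by rewrite -scalemxAr -scalemxAl !mxE.
have [BT|BT] := eqVneq (B + B^T) 0.
  (* The vanishing of [B + B^T] reads [2 p p^T = 4 a (A + A^T)]. *)
  right; exists (2%:R * a)^-1, p.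
  have a4 : 4%:R * a != 0 by rewrite mulf_neq0.
  apply: (scalerI a4); rewrite scalerA.
  have -> : 4%:R * a * (2%:R * a)^-1 = 2%:R by field.
  have BTE : B^T = p *m p^T - (4%:R * a) *: A^T.
    by rewrite /B linearB linearZ /= trmx_mul trmxK.
  apply/eqP; rewrite eq_sym -subr_eq0 scalerDr scaler_nat mulr2n opprD addrACA.
  by rewrite -BTE BT.
have [v0 [v0b Dv0]] := small_vector BT.
left.
have [i0 ui0] : exists i0, u 0 i0 = 1.
  apply: NNPP => none; have u0 : u = 0.
    apply/rowP => i; rewrite mxE; have := ub i.
    have : u 0 i <> 1 by move=> e; apply: none; exists i.
    by clear; lia.
  by move: a0; rewrite /a u0 map_mx0 /bil !mul0mx mxE eqxx.
(* Subtracting a multiple of [u] leaves the discriminant unchanged and clears the entry at [i0]. All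
   entries being 0 or 1, the difference stays within [-1, 1]. *)
pose v := v0 - v0 0 i0 *: u.
have Dv : qdisc a (polar A (qrow u) (qrow v)) (bil A (qrow v) (qrow v)) != 0.
  move: Dv0; rewrite bB; congr (_ != _).
  have -> : qrow v = qrow v0 + (- (v0 0 i0)%:~R) *: qrow u.
    by apply/rowP => i; rewrite !mxE intrB intrM; ring.
  by rewrite /qdisc /polar !bilE -/a; ring.
have vb i : `|v 0 i| <= 1.
  rewrite !mxE; have := v0b i; have := v0b i0; have := ub i.
  have [->|->] : v0 0 i0 = 0 \/ v0 0 i0 = 1 by have := v0b i0; clear; lia.
    by rewrite mul0r; move: (v0 0 i) (u 0 i) => x y; clear; lia.
  by rewrite mul1r; move: (v0 0 i) (u 0 i) => x y; clear; lia.
have [j0 vj0] : exists j0, v 0 j0 != 0.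
  apply: NNPP => none; have v_0 : v = 0.
    apply/rowP => i; rewrite [RHS]mxE; apply/eqP/negPn/negP => e.
    by apply: none; exists i.
  move: Dv; rewrite v_0 map_mx0 /qdisc /polar /bil trmx0 !mul0mx !mulmx0 !mxE.
  by rewrite !addr0 expr0n mulr0 subrr eqxx.
exists u, v, i0, j0; split=> //.
- by rewrite !mxE ui0 mulr1 subrr.
- have [->|->//] : v 0 j0 = 1 \/ v 0 j0 = -1 by have := vb j0; clear - vj0; lia.
  by rewrite expr1n.
- by split=> // i; have := ub i; clear; lia.
Qed.

End Frame.

(** * Singular slices and factorisations *)

Lemma meval_cdisc (n : nat) (x : 'I_n -> rat) (a b c d e g : {mpoly rat[n]}) :
  (cdisc a b c d e g).@[x] = cdisc a.@[x] b.@[x] c.@[x] d.@[x] e.@[x] g.@[x].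
Proof.
have h4 : (4%:R : {mpoly rat[n]}).@[x] = 4%:R by rewrite mevalMn meval1.
rewrite /cdisc /qdisc -h4; move: (4%:R : {mpoly rat[n]}) => k.
by rewrite !expr2 !(mevalD, mevalN, mevalM).
Qed.

Section Irreducible.
Variables (n : nat) (A : 'M[rat]_n) (l : 'cV[rat]_n) (c : rat).
Let f := qpoly A l c.

Definition dpoly (u : 'rV[rat]_n) : {mpoly rat[n]} :=
  (lin l u)%:MP + linpoly ((A + A^T) *m u^T).

Lemma meval_dpoly u (x : 'rV[rat]_n) : (dpoly u).@[fun i => x 0 i] = quadf' A l u x.
Proof.
have := meval_qpoly 0 ((A + A^T) *m u^T) (lin l u) x.
rewrite /qpoly quadpoly0 addr0 => ->.
by rewrite /quadf /quadf' polar_lin /bil mulmx0 mul0mx mxE addr0 addrC.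
Qed.

Lemma msize_dpoly u : (msize (dpoly u) <= 2)%N.
Proof.
apply: msizeD_leq; first exact: leq_trans (msizeC_leq _ _) _.
exact: msize_homog_leq (linpoly_homog _).
Qed.

(* If all slices were singular, completing the square would split [f] over [Q]. *)
Lemma irreducible_slice_cdisc (u v : 'rV[rat]_n) (s : rat) :
  let D := qdisc (bil A u u) (polar A u v) (bil A v v) in
  msize f = 3 -> mirreducible f -> bil A u u != 0 -> D != 0 -> s ^+ 2 = D ->
  exists t : 'rV[int]_n, slice_cdisc A l c u v (qrow t) != 0.
Proof.
set a := bil A u u; set b := polar A u v; set d := bil A v v => D sf [_ irr] a0 D0 sD.
apply: NNPP => none.
have Th0 t : slice_cdisc A l c u v (qrow t) = 0.
  by apply/eqP/negPn/negP => e; apply: none; exists t.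
pose du := dpoly u; pose dv := dpoly v.
pose Th := cdisc a%:MP b%:MP d%:MP du dv f.
have D_mp : qdisc a%:MP b%:MP d%:MP = D%:MP :> {mpoly rat[n]}.
  by rewrite /qdisc /D /qdisc mpolyCB !expr2 !mpolyCM mpolyC_nat.
have f3 : (msize f <= 3)%N by rewrite sf.
have sC (k : rat) p : (msize p <= 3)%N -> (msize (k%:MP_[n] * p) <= 3)%N.
  by move=> h; apply: (@msizeM_leq _ _ _ 0 2) => //; apply: msizeC_leq.
have sThle : (msize Th <= 3)%N.
  rewrite /Th /cdisc D_mp.
  have m2 (p q : {mpoly rat[n]}) : (msize p <= 2)%N -> (msize q <= 2)%N -> (msize (p * q) <= 3)%N.
    by move=> h1 h2; apply: (@msizeM_leq _ _ _ 1 1).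
  apply: msizeD_leq; last exact: sC.
  apply: msizeD_leq; last by apply: sC; rewrite expr2; apply: m2; apply: msize_dpoly.
  apply: msizeB_leq; first by apply: sC; rewrite expr2; apply: m2; apply: msize_dpoly.
  by rewrite -mulrA; apply: sC; apply: m2; apply: msize_dpoly.
(* The degree is at most 2, since [D] is constant and [du], [dv] have degree at most 1; vanishing at
   all integer points therefore makes the polynomial zero. *)
have ThE : Th = 0.
  have [A' [l' [c' E]]] := qpoly_exists sThle.
  rewrite E; apply: qpoly_eq0 => t; rewrite -meval_qpoly -E -[RHS](Th0 t).
  by rewrite /Th meval_cdisc !mevalC !meval_dpoly meval_qpoly.
(* Completing the square with polynomial coefficients, at the origin of the slice through a generic
   point, gives [4 a D f = D du^2 - (b du - 2 a dv)^2], a difference of squares because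
   [D = s^2]. *)
have key : (4%:R * a * D)%:MP * f =
    (s%:MP * du - (b%:MP * du - 2%:R * a%:MP * dv)) *
    (s%:MP * du + (b%:MP * du - 2%:R * a%:MP * dv)).
  have := conic_norm a%:MP b%:MP d%:MP du dv f 0 0.
  rewrite -/Th ThE D_mp /conic !(expr0n, mulr0, add0r) /= => E.
  rewrite !mpolyCM mpolyC_nat -[LHS]opprK -E -sD expr2 mpolyCM; ring.
have k0 : 4%:R * a * D != 0 by rewrite !mulf_neq0.
set k := 4%:R * a * D in key k0.
set g := _ - _ in key; set h := s%:MP * du + _ in key.
have fE : f = (k^-1%:MP * g) * h.
  by rewrite -mulrA -key mulrA -mpolyCM mulVf // mpolyC1 mul1r.
have sl (x y : rat) : (msize (x%:MP_[n] * du) <= 2)%N /\ (msize (y%:MP_[n] * dv) <= 2)%N.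
  by split; apply: (@msizeM_leq _ _ _ 0 1); rewrite ?msizeC_leq ?msize_dpoly.
have sw : (msize (b%:MP * du - 2%:R * a%:MP * dv) <= 2)%N.
  rewrite -mpolyC_nat -mpolyCM; apply: msizeB_leq.
    by have [] := sl b 0.
  by have [] := sl 0 (2%:R * a).
have sg : (msize (k^-1%:MP * g) <= 2)%N.
  apply: (@msizeM_leq _ _ _ 0 1); first exact: msizeC_leq.
  by apply: msizeB_leq => //; have [] := sl s 0.
have sh : (msize h <= 2)%N.
  by apply: msizeD_leq => //; have [] := sl s 0.
(* Both factors have degree at most 1 and [f] has degree 2, so neither factor is constant. *)
case: (irr _ _ fE) => small.
  by have := @msizeM_leq _ _ _ 0 1 small sh; rewrite -fE sf.
by have := @msizeM_leq _ _ _ 1 0 sg small; rewrite -fE sf.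
Qed.

End Irreducible.

Lemma msize_homog1 (n : nat) (p : {mpoly rat[n]}) :
  p \is 1.-homog -> (msize p <= 1)%N -> p = 0.
Proof.
move=> /dhomogP h s1; apply/eqP; rewrite -msupp_eq0.
case E : (msupp p) => [//|m r].
have mp : m \in msupp p by rewrite E mem_head.
by have := leq_trans (msize_mdeg_lt mp) s1; have /= -> := h _ mp.
Qed.

(** With [P] the linear form of [p], the polynomial is [c + linpoly l + (k / 2) P^2]. It is thus a
    polynomial in [linpoly l] and [P], and its quadratic part is zero or a product of two linear
    forms. *)
Lemma rank_one_excluded (n : nat) (A : 'M[rat]_n) (l p : 'cV[rat]_n) (c k : rat) :
  A + A^T = k *: (p *m p^T) ->
  ~ (~ poly_in_two_linear_forms (qpoly A l c) \/ mirreducible (quad_part (qpoly A l c))).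
Proof.
move=> AE; pose k2 := 2%:R^-1 * k; pose P := linpoly p.
have qA : quadpoly A = (k2 *: P) * P.
  by rewrite quadpoly_sym AE quadpolyZ quadpoly_outer scalerA -scalerAl.
case=> [two|[sq irr]].
  apply: two; exists (c%:MP + 'X_(0 : 'I_2) + k2 *: ('X_(1 : 'I_2) * 'X_(1 : 'I_2))).
  exists (linpoly l), P; split; [exact: linpoly_homog | split; first exact: linpoly_homog].
  rewrite /qpoly qA !comp_mpolyD comp_mpolyC comp_mpolyZ rmorphM /= !comp_mpolyXU /=.
  by rewrite -scalerAl.
rewrite quad_part_qpoly in sq irr.
have Ph : P \is 1.-homog by apply: linpoly_homog.
suff q0 : quadpoly A = 0 by rewrite q0 mmeasure0 in sq.
case: (irr _ _ qA) => small; rewrite qA.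
  by rewrite (msize_homog1 (dhomogZ k2 Ph) small) mul0r.
by rewrite (msize_homog1 Ph small) mulr0.
Qed.

Lemma mpoly_zeros_size (n k : nat) : (2 < n)%N -> (0 < k)%N -> exists C : nat,
  forall f : {mpoly rat[n]}, mirreducible f -> mtotdeg_eq f 2 ->
  (~ poly_in_two_linear_forms f \/ mirreducible (quad_part f)) ->
  forall (N : nat) (L : seq 'rV[int]_n), (0 < N)%N -> uniq L ->
  (forall a, a \in L -> f.@[fun i => qrow a 0 i] = 0) ->
  (forall a, a \in L -> forall i, `|a 0 i| <= N%:Z) ->
  (size L ^ k <= C * N ^ (k * (n - 2) + 1))%N.
Proof.
move=> n2 k0; have [C hC] := quadric_size n2 k0; exists C => f irr deg hyp N L N0 uL hL bL.
have f3 : (msize f <= 3)%N by rewrite deg.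
have [A [l [c fE]]] := qpoly_exists f3; rewrite fE in irr deg hyp hL.
have A0 : A + A^T != 0.
  apply/eqP => AT; move: deg; rewrite /mtotdeg_eq /qpoly quadpoly_sym AT quadpoly0 scaler0 addr0.
  have := msizeD_leq (leq_trans (msizeC_leq n c) (isT : (1 <= 2)%N)) (msize_homog_leq (linpoly_homog l)).
  by move=> + e; rewrite e.
case: (slice_frame A0) => [|[k' [p AE]]]; last by case: (rank_one_excluded AE hyp).
case=> u [v [i0 [j0 [ui0 vi0 vj0 [ub vb] [a0 D0]]]]].
apply: (hC A l c u v i0 j0) => //; last by move=> a /hL; rewrite meval_qpoly.
have [[s sD]|nsq] := classic (exists s, s ^+ 2 = qdisc (bil A (qrow u) (qrow u))
    (polar A (qrow u) (qrow v)) (bil A (qrow v) (qrow v))).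
  by right; apply: irreducible_slice_cdisc sD.
by left=> x; apply/eqP => e; apply: nsq; exists x.
Qed.

Lemma box_zeros_card (n k : nat) : (2 < n)%N -> (0 < k)%N -> exists C : nat,
  forall f : {mpoly rat[n]}, mirreducible f -> mtotdeg_eq f 2 ->
  (~ poly_in_two_linear_forms f \/ mirreducible (quad_part f)) ->
  forall N : nat, (0 < N)%N ->
  (#|[set a : {ffun 'I_n -> 'I_(2 * N + 1)} | f.@[box_point a] == 0%R]| ^ k
     <= C * N ^ (k * (n - 2) + 1))%N.
Proof.
move=> n2 k0; have [C hC] := mpoly_zeros_size n2 k0; exists C => f irr deg hyp N N0.
pose row (a : {ffun 'I_n -> 'I_(2 * N + 1)}) : 'rV[int]_n := \row_i (Posz (a i) - Posz N).
rewrite cardE -(size_map row); apply: (hC f) => //.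
- rewrite map_inj_uniq ?enum_uniq // => a b /rowP ab.
  apply/ffunP => i; apply: val_inj; have := ab i; rewrite !mxE.
  by move/addIr; case.
- move=> _ /mapP[a + ->]; rewrite mem_enum inE => /eqP <-.
  by apply: meval_eq => i; rewrite !mxE.
- move=> _ /mapP[a _ ->] i; rewrite mxE; have := ltn_ord (a i).
  by move: (nat_of_ord (a i)); clear; lia.
Qed.

(** * Passage to real box sizes and exponents *)

Module RealBound.
Import Stdlib.Reals.Reals Stdlib.micromega.Lra.
Local Open Scope R_scope.

Lemma INR_expn (m k : nat) : INR (expn m k) = INR m ^ k.
Proof. by elim: k => [//|k IH]; rewrite expnS mult_INR IH. Qed.

Lemma pow_lt_compat (x y : R) (k : nat) : 0 <= x -> x < y -> leq 1 k -> x ^ k < y ^ k.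
Proof.
move=> x0 xy; case: k => // k _; elim: k => [|k IH]; first by rewrite !pow_1.
have y0 : 0 < y ^ k.+1 by apply: pow_lt; Lra.lra.
change (x * x ^ k.+1 < y * y ^ k.+1); apply: Rle_lt_trans (_ : x * y ^ k.+1 < _).
  by apply: Rmult_le_compat_l => //; Lra.lra.
exact: Rmult_lt_compat_r.
Qed.

(** The comparison is made between [k]-th powers: [k * m + 1 <= k * (m + eps)] bounds the power of
    [B], and [C + 1 >= 1] is at most its own [k]-th power, so no root of [C] is taken. *)
Lemma real_of_nat_bound (a C N m k : nat) (B eps : R) :
  1 <= B -> INR N <= B -> leq 1 k -> 1 <= INR k * eps ->
  leq (expn a k) (muln C (expn N (addn (muln k m) 1))) ->
  INR a <= (INR C + 1) * Rpower B (INR m + eps).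
Proof.
move=> B1 NB k0 keps /ssrnat.leP/le_INR; rewrite mult_INR !INR_expn => h.
have B0 : 0 < B by Lra.lra.
have C0 := pos_INR C; have N0 := pos_INR N.
have P0 : 0 < Rpower B (INR m + eps) by apply: exp_pos.
apply: Rnot_lt_le => lt.
have : ((INR C + 1) * Rpower B (INR m + eps)) ^ k < INR a ^ k.
  by apply: pow_lt_compat => //; apply: Rmult_le_pos; Lra.lra.
apply: Rle_not_lt; apply: Rle_trans h _.
rewrite Rpow_mult_distr; apply: Rmult_le_compat => //.
- exact: pow_le.
- apply: Rle_trans (_ : INR C + 1 <= _); first by Lra.lra.
  rewrite -{1}(pow_1 (INR C + 1)); apply: Rle_pow; first by Lra.lra.
  by apply/ssrnat.leP.
apply: Rle_trans (pow_incr _ _ _ (conj N0 NB)) _.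
rewrite -Rpower_pow // -(Rpower_pow k) // Rpower_mult.
apply: Rle_Rpower => //; rewrite plus_INR mult_INR.
change (INR 1) with 1; Lra.lra.
Qed.

Lemma Int_part_floor (B : R) : 1 <= B ->
  leq 1 (BinInt.Z.to_nat (Int_part B)) /\ INR (BinInt.Z.to_nat (Int_part B)) <= B.
Proof.
move=> B1; have [h1 h2] := base_Int_part B.
have z0 : BinInt.Z.lt 0 (Int_part B) by apply: lt_IZR; Lra.lra.
split; first by apply/ssrnat.leP; Lia.lia.
rewrite INR_IZR_INZ Znat.Z2Nat.id //; Lia.lia.
Qed.

Lemma archimed_inv (eps : R) : 0 < eps -> exists k : nat, leq 1 k /\ 1 <= INR k * eps.
Proof.
move=> e0; have [k hk] := INR_unbounded (/ eps).
exists k.+1; split=> //; rewrite S_INR.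
have : / eps * eps < INR k * eps by apply: Rmult_lt_compat_r.
rewrite Rinv_l; Lra.lra.
Qed.

Lemma INR_sub2 (n : nat) : leq 3 n -> INR n - 2 = INR (subn n 2).
Proof. by move=> /ssrnat.leP h; rewrite minus_INR //; Lia.lia. Qed.

End RealBound.

Theorem theorem2 (n : nat) (hn : (3 <= n)%N) (eps : Rdefinitions.R)
    (heps : Rdefinitions.Rlt (Rdefinitions.IZR BinNums.Z0) eps) :
  exists C : Rdefinitions.R,
    forall (f : {mpoly rat[n]}),
      mirreducible f ->
      mtotdeg_eq f 2 ->
      (~ poly_in_two_linear_forms f \/ mirreducible (quad_part f)) ->
      forall B : Rdefinitions.R,
        Rdefinitions.Rle (Rdefinitions.IZR (BinNums.Zpos BinNums.xH)) B ->
        Rdefinitions.Rle (Raxioms.INR (nfB f B))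
          (Rdefinitions.Rmult C
             (Rpower.Rpower B
                (Rdefinitions.Rplus
                   (Rdefinitions.Rminus (Raxioms.INR n) (Rdefinitions.IZR (BinNums.Zpos (BinNums.xO BinNums.xH)))) eps))).
Proof.
(* [k] and then [C] are fixed before [f] and [B], so the constant depends on [n] and [eps] only. *)
have [k [k0 keps]] := RealBound.archimed_inv heps.
have [C hC] := box_zeros_card hn k0.
exists (Rdefinitions.Rplus (Raxioms.INR C) (Rdefinitions.IZR (BinNums.Zpos BinNums.xH))).
move=> f irr deg hyp B B1; have [N0 NB] := RealBound.Int_part_floor B1.
rewrite (RealBound.INR_sub2 hn).
exact: RealBound.real_of_nat_bound B1 NB k0 keps (hC f irr deg hyp _ N0).
Qed.
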